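(* As $r \to \infty$, \[ f_3\!\left(r, \{\mathcal{C}_2^{(3)}, \mathcal{C}_3^{(3)}, \mathcal{C}_4^{(3)}\}\right) = r + o(r). \]
   Context: Let $r \ge 3$ and $k$ be positive integers. A $3$-uniform hypergraph $G$ is an $(r,k)$-hypergraph if $V(G)$ can be partitioned into sets $V_1,\dots,V_r$ with $|V_i| \le k$ for all $i$ such that for every $3$-element subset $\{i_1,i_2,i_3\}$ of $[r]$ there is an edge $e \in E(G)$ with $|e \cap V_{i_j}| = 1$ for $j=1,2,3$. For a family $\mathcal{F}$ of $3$-uniform hypergraphs, $f_3(r,\mathcal{F})$ is the minimum $k$ such that there exists a $3$-uniform $(r,k)$-hypergraph containing no member of $\mathcal{F}$ as a subgraph. For a graph $F$, a hypergraph $H$ is a Berge-$F$ if there is a bijection $\phi: E(F) \to E(H)$ with $e \subseteq \phi(e)$ for every $e \in E(F)$. $\mathcal{C}_\ell^{(3)}$ is the family of $3$-uniform Berge cycles of length $\ell$, i.e. $3$-uniform Berge-$C_\ell$ hypergraphs (for $\ell = 2$: two distinct edges together with two distinct vertices each contained in both edges). $o(r)$ denotes a quantity $h(r)$ with $h(r)/r \to 0$. *)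

(* Defs.v *)
From mathcomp Require Import all_boot.
From mathcomp Require Import boolp.

Set Implicit Arguments.
Unset Strict Implicit.
Unset Printing Implicit Defensive.

Record hypergraph3 := Hypergraph3 {
  vertices :> finType;
  edges : {set {set vertices}};
  edges_card3 : forall e, e \in edges -> #|e| = 3
}.

Definition hypergraph_family := hypergraph3 -> Prop.

(* Subgraph up to isomorphism, not necessarily induced. *)
Definition contains (G H : hypergraph3) : Prop :=
  exists2 f : H -> G, injective f &
    forall e : {set H}, e \in edges H -> f @: e \in edges G.

(* Graphs are given by named edges with their sets of ends, so that parallel
   edges are allowed: the cycle of length 2 is a double edge. *)
Record multigraph := Multigraph {
  mvertices : finType;
  medges : finType;
  ends : medges -> {set mvertices}
}.

Definition cycle_graph (l : nat) : multigraph :=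
  @Multigraph 'I_l 'I_l (fun i => [set i; ordS i]).

(* The injection j realises the vertices of F as vertices of H; the last two
   conditions say that phi is a bijection from E(F) onto E(H). *)
Definition berge (F : multigraph) : hypergraph_family := fun H =>
  exists (j : mvertices F -> H) (phi : medges F -> {set H}),
    [/\ injective j,
        forall x, j @: ends x \subset phi x,
        injective phi &
        forall e : {set H}, e \in edges H <-> exists x, phi x = e].

Definition berge_cycles (l : nat) : hypergraph_family :=
  berge (cycle_graph l).

Definition berge_cycles_234 : hypergraph_family := fun H =>
  [\/ berge_cycles 2 H, berge_cycles 3 H | berge_cycles 4 H].

Definition is_rk_hypergraph (r k : nat) (G : hypergraph3) : Prop :=
  exists V : 'I_r -> {set G},
    [/\ (\bigcup_(i < r) V i) = [set: G],
        forall i j, i != j -> [disjoint V i & V j],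
        forall i, #|V i| <= k &
        forall I : {set 'I_r}, #|I| = 3 ->
          exists2 e : {set G}, e \in edges G &
            forall i, i \in I -> #|e :&: V i| = 1].

Definition admissible (r : nat) (F : hypergraph_family) (k : nat) : Prop :=
  0 < k /\ exists2 G : hypergraph3, is_rk_hypergraph r k G &
             forall H, F H -> ~ contains G H.

(* The value is 0 when no k is admissible; since 0 is never admissible, this
   cannot be confused with a genuine minimum. *)
Definition f3 (r : nat) (F : hypergraph_family) : nat :=
  if pselect (exists k, `[< admissible r F k >]) is left ex
  then ex_minn ex else 0.

Lemma f3P (r : nat) (F : hypergraph_family) :
  (exists k, admissible r F k) ->
  admissible r F (f3 r F) /\ forall k, admissible r F k -> f3 r F <= k.
Proof.
move=> [k Ak]; rewrite /f3; case: pselect => [ex|[]].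
  case: ex_minnP => m /asboolP Am minm.
  by split=> // k' Ak'; apply/minm/asboolP.
by exists k; apply/asboolP.
Qed.

(* Main.v *)
Require Import Defs.
From HB Require Import structures.
From mathcomp Require Import all_boot all_order all_algebra.
From mathcomp Require Import all_classical all_reals all_analysis.
From mathcomp Require Import finfield.
From mathcomp Require Import ring lra zify.
Import Order.TTheory GRing.Theory Num.Theory.
Import numFieldNormedType.Exports.

(* Lower bound.  Without Berge cycles of length 2, 3, 4, a pair of vertices is
   joined by at most one path of two distinct edges, so the n <= rk vertices
   satisfy sum_v 4 d(v) (d(v) - 1) <= n^2, while sum_v d(v) >= 3 C(r,3);
   convexity of d^2 then forces k >= r - 4.

   Upper bound.  For an odd prime power q >= r, let (x, y) and (x', y') in
   F_q x F_q be adjacent when x <> x' and y + y' = x x'.  This graph has no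
   C_4, and over any three values of x there is exactly one triangle, because
   2 is invertible.  The hypergraph of its triangles over r values of x, with
   the fibres of x as parts, shows f_3 <= q.

   It remains to find an odd prime power in [n, (1 + eps) n] for all large n.
   This is Erdos's deduction from Selberg's formula
     psi(x) ln x + sum_k Lambda(k) psi(x / k) = 2 x ln x + O(x).
   The formula bounds the density of psi in every window by 2.  Suppose that
   windows ]x, lam x] of arbitrarily small density exist, with lam almost
   maximal.  By the formula again, for almost all prime powers n the window
   ]x / n, lam x / n] has density almost 2.  As lam is almost maximal such n
   occur in every window of ratio slightly above lam, so that these windows
   can be chained to almost cover a long interval, on which psi then has
   density almost 2.  This contradicts Chebyshev's bound
   psi(y) <= 5/3 y + o(y). *)

Local Open Scope classical_set_scope.
Local Open Scope ring_scope.

(** * Von Mangoldt and Moebius functions *)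

Section ArithmeticFunctions.
Set Implicit Arguments.
Unset Strict Implicit.
Variable R : realType.
Implicit Types (f g h : nat -> R) (d e k m n p N : nat).

Lemma sum_multiples d N f : (0 < d)%N ->
  \sum_(1 <= k < N.+1 | (d %| k)%N) f (k %/ d)%N =
  \sum_(1 <= e < (N %/ d).+1) f e.
Proof.
move=> d0; elim: N => [|N IH]; first by rewrite div0n !big_geq.
rewrite big_mkcond big_nat_recr //= -big_mkcond IH divnS //.
case: ifP => dN; last by rewrite add0n addr0.
by rewrite dN add1n [RHS]big_nat_recr.
Qed.

Lemma sum_divisor_pairs (f : nat -> nat -> R) N :
  \sum_(1 <= k < N.+1) \sum_(1 <= d < N.+1 | (d %| k)%N) f d (k %/ d)%N =
  \sum_(1 <= d < N.+1) \sum_(1 <= e < (N %/ d).+1) f d e.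
Proof.
under eq_bigr do rewrite big_mkcond.
rewrite exchange_big /=; apply: eq_big_nat => d /andP[d0 _].
by rewrite -big_mkcond sum_multiples.
Qed.

Lemma sum_divisors_widen f n N : (0 < n <= N)%N ->
  \sum_(1 <= d < N.+1 | (d %| n)%N) f d =
  \sum_(1 <= d < n.+1 | (d %| n)%N) f d.
Proof.
move=> /andP[n0 nN]; rewrite [RHS](big_nat_widen _ _ N.+1) //.
apply: eq_bigl => d; case: (boolP (d %| n)%N) => //= dn.
by rewrite ltnS (dvdn_leq n0 dn).
Qed.

(** A number above 1 is a prime power exactly when it is the full power of its least prime factor
    [pdiv n]. *)
Definition mangoldt n : R :=
  if (1 < n)%N && (n == pdiv n ^ logn (pdiv n) n)%N then ln (pdiv n)%:R else 0.

Lemma mangoldt_ge0 n : 0 <= mangoldt n.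
Proof.
rewrite /mangoldt; case: ifP => // /andP[n1 _].
by rewrite ln_ge0 // ler1n pdiv_gt0.
Qed.

Lemma mangoldt_pfactor p k : prime p -> (0 < k)%N ->
  mangoldt (p ^ k) = ln p%:R.
Proof.
move=> pp; case: k => // k _; rewrite /mangoldt pdiv_pfactor //.
rewrite pfactorK // eqxx.
by rewrite andbT -(exp1n k.+1) ltn_exp2r // prime_gt1.
Qed.

Lemma mangoldt_neq0 n : mangoldt n != 0 ->
  exists p k, [/\ prime p, (0 < k)%N & n = (p ^ k)%N].
Proof.
rewrite /mangoldt; case: ifP; rewrite ?eqxx // => /andP[n1 /eqP nE] _.
exists (pdiv n), (logn (pdiv n) n); split=> //; first exact: pdiv_prime.
by rewrite logn_gt0 mem_primes pdiv_prime // pdiv_dvd ltnW.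
Qed.

(** Induction on [n = p * m]: the only prime power dividing n but not m is the full power of p in n,
    and it contributes the missing [ln p]. *)
Lemma sum_mangoldt_divisors n : (0 < n)%N ->
  \sum_(1 <= d < n.+1 | (d %| n)%N) mangoldt d = ln n%:R.
Proof.
elim/ltn_ind: n => n IH n0.
have [n1|n1] := leqP n 1.
  have -> : n = 1%N by apply/eqP; rewrite eqn_leq n1.
  by rewrite big_mkcond big_nat1 /= /mangoldt /= ln1.
set p := pdiv n; have pp : prime p by exact: pdiv_prime.
have p0 := prime_gt0 pp.
have nE : n = (p * (n %/ p))%N by rewrite mulnC divnK // pdiv_dvd.
set m := (n %/ p)%N in nE.
have m0 : (0 < m)%N by move: n0; rewrite nE muln_gt0 => /andP[].
have mn : (m < n)%N by rewrite ltn_Pdiv // prime_gt1.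
rewrite (bigID (fun d => d %| m)%N) /=.
have -> : \sum_(1 <= d < n.+1 | (d %| n)%N && (d %| m)%N) mangoldt d = ln m%:R.
  rewrite -IH // -(@sum_divisors_widen _ _ n) ?m0 1?ltnW //.
  apply: eq_bigl => d; apply/andP/idP => [[] //|dm]; split=> //.
  by rewrite nE dvdn_mull.
rewrite [in RHS]nE natrM lnM ?posrE ?ltr0n // addrC; congr (_ + _).
have lnp : logn p n = (logn p m).+1 by rewrite nE lognM // logn_prime // eqxx.
set q := (p ^ (logn p m).+1)%N.
have qn : (q %| n)%N by rewrite pfactor_dvdn // lnp.
have qm : ~~ (q %| m)%N by rewrite pfactor_dvdn // ltnn.
rewrite -big_filter (bigD1_seq q) ?filter_uniq ?iota_uniq //; last first.
  rewrite mem_filter qn qm mem_index_iota expn_gt0 p0 /= ltnS.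
  by rewrite (dvdn_leq n0).
rewrite mangoldt_pfactor // big1_seq /= ?addr0 // => d /=.
rewrite mem_filter => /andP[dq /andP[/andP[dn dm] _]].
apply/eqP/contraT => /mangoldt_neq0[r [k [pr k0 dE]]]; move: dn dm dq.
rewrite dE; have [->|rp] := eqVneq r p.
  rewrite !pfactor_dvdn // lnp -ltnNge => h1 h2.
  have -> : k = (logn p m).+1 by apply/eqP; rewrite eqn_leq h1.
  by rewrite eqxx.
rewrite nE Gauss_dvdr => [->//|].
by rewrite coprimeXl // prime_coprime // dvdn_prime2.
Qed.

(** * The Moebius function and its divisor sums *)

Definition squarefree n := all (fun p => logn p n == 1)%N (primes n).

Definition moebius n : R :=
  if squarefree n then (-1) ^+ size (primes n) else 0.

Lemma normr_moebius n : `|moebius n| <= 1.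
Proof.
by rewrite /moebius; case: ifP => _; rewrite ?normr0 // normrX normrN1 expr1n.
Qed.

Lemma moebius_pM_dvd p n : prime p -> (0 < n)%N -> (p %| n)%N ->
  moebius (p * n) = 0.
Proof.
move=> pp n0 pn; rewrite /moebius ifF //; apply/negbTE/allPn; exists p.
  by rewrite mem_primes pp muln_gt0 prime_gt0 // n0 dvdn_mulr.
have p0 := prime_gt0 pp.
rewrite lognM // logn_prime // eqxx add1n eqSS -lt0n.
by rewrite logn_gt0 mem_primes pp n0.
Qed.

Lemma moebius_pM_ndvd p n : prime p -> (0 < n)%N -> ~~ (p %| n)%N ->
  moebius (p * n) = - moebius n.
Proof.
move=> pp n0 pn; have p0 := prime_gt0 pp.
have pNn : p \notin primes n by rewrite mem_primes (negbTE pn) !andbF.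
have pE : perm_eq (primes (p * n)) (p :: primes n).
  apply: uniq_perm; rewrite ?primes_uniq //= ?pNn ?primes_uniq // => q.
  by rewrite primesM // primes_prime // !inE.
rewrite /moebius /squarefree (perm_all _ pE) (perm_size pE) /= exprS mulN1r.
rewrite lognM // logn_prime // eqxx lognE pp n0 (negbTE pn) /=.
have -> : all (fun q => logn q (p * n) == 1)%N (primes n) =
          all (fun q => logn q n == 1)%N (primes n).
  apply: eq_in_all => q qn; rewrite lognM // logn_prime //.
  by have [pq|//] := eqVneq q p; rewrite pq in qn; rewrite qn in pNn.
by case: ifP; rewrite ?oppr0.
Qed.

(* Divisors divisible by p cancel against those prime to p, up to the
   difference of the values of h. *)
Lemma sum_moebius_pM h p m : prime p -> (0 < m)%N ->
  \sum_(1 <= d < (p * m).+1 | (d %| p * m)%N) moebius d * h d =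
  \sum_(1 <= d < m.+1 | (d %| m)%N && ~~ (p %| d)%N)
    moebius d * (h d - h (p * d)%N).
Proof.
move=> pp m0; have p0 := prime_gt0 pp.
rewrite (bigID (fun d => p %| d)%N) /= addrC.
under [RHS]eq_bigr do rewrite mulrBr.
rewrite sumrB; congr (_ + _).
  rewrite [RHS](big_nat_widen _ _ (p * m).+1) /=; last first.
    by rewrite ltnS leq_pmull.
  apply: eq_bigl => d; case: (boolP (p %| d)%N) => pd; first by rewrite !andbF.
  rewrite /= !andbT.
  rewrite Gauss_dvdr; last by rewrite coprime_sym prime_coprime.
  by case: (boolP (d %| m)%N) => //= /(dvdn_leq m0) dm; rewrite ltnS dm.
pose g e := if (e %| m)%N then moebius (p * e) * h (p * e)%N else 0.
transitivity (\sum_(1 <= d < (p * m).+1 | (p %| d)%N) g (d %/ p)%N).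
  rewrite [LHS]big_mkcondl /=; apply: eq_bigr => d pd; rewrite /g.
  have dE : d = (p * (d %/ p))%N by rewrite mulnC divnK.
  by rewrite {1}dE dvdn_pmul2l // -dE.
rewrite sum_multiples // mulKn // -sumrN [RHS]big_mkcond /=.
apply: eq_big_nat => e /andP[e0 _]; rewrite /g; case: ifP => //= em.
case: (boolP (p %| e)%N) => pe /=; first by rewrite moebius_pM_dvd // mul0r.
by rewrite moebius_pM_ndvd // mulNr.
Qed.

Lemma sum_moebius n : (0 < n)%N ->
  \sum_(1 <= d < n.+1 | (d %| n)%N) moebius d = (n == 1)%N%:R.
Proof.
move=> n0; have [n1|n1] := leqP n 1.
  have -> : n = 1%N by apply/eqP; rewrite eqn_leq n1.
  by rewrite big_mkcond big_nat1 /= /moebius /= expr0.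
have nE : n = (pdiv n * (n %/ pdiv n))%N by rewrite mulnC divnK // pdiv_dvd.
rewrite gtn_eqF // nE.
transitivity (\sum_(1 <= d < (pdiv n * (n %/ pdiv n)).+1 |
    (d %| pdiv n * (n %/ pdiv n))%N) moebius d * (fun=> 1) d).
  by apply: eq_bigr => d _; rewrite mulr1.
rewrite sum_moebius_pM ?pdiv_prime //; last first.
  by rewrite divn_gt0 ?pdiv_gt0 // dvdn_leq // pdiv_dvd.
by rewrite big1 // => d _; rewrite subrr mulr0.
Qed.

(** For [h = ln] every difference in [sum_moebius_pM] equals [- ln p], with p the least prime factor
    of n. The remaining sum of [moebius] runs over the divisors of the part of n prime to p, so it
    is 1 if n is a power of p and 0 otherwise. *)
Lemma sum_moebius_ln n : (0 < n)%N ->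
  \sum_(1 <= d < n.+1 | (d %| n)%N) moebius d * ln d%:R = - mangoldt n.
Proof.
move=> n0; have [n1|n1] := leqP n 1.
  have -> : n = 1%N by apply/eqP; rewrite eqn_leq n1.
  by rewrite big_mkcond big_nat1 /= /mangoldt /= ln1 mulr0 oppr0.
have pp := pdiv_prime n1; set p := pdiv n in pp.
have p0 := prime_gt0 pp.
have nE : n = (p * (n %/ p))%N by rewrite mulnC divnK // pdiv_dvd.
have m0 : (0 < n %/ p)%N by rewrite divn_gt0 // dvdn_leq // pdiv_dvd.
rewrite {1 2}nE sum_moebius_pM //; set m := (n %/ p)%N in nE m0 *.
have q0 : (0 < n`_p^')%N by exact: part_gt0.
have pNq : ~~ (p %| n`_p^')%N.
  by rewrite -prime_coprime // (@pnat_coprime p) ?part_pnat ?pnat_id.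
transitivity (- ln p%:R * \sum_(1 <= d < n.+1 | (d %| n`_p^')%N) moebius d).
  rewrite mulr_sumr (big_nat_widen _ m.+1 n.+1) /=; last first.
    by rewrite ltnS leq_div.
  rewrite big_nat_cond [RHS]big_nat_cond; apply: eq_big => d.
    case: (boolP (1 <= d < n.+1)%N) => //= /andP[d0 _].
    case: (boolP (p %| d)%N) => pd.
      rewrite andbF /=; apply/esym/negbTE; apply: contraNN pNq.
      exact: dvdn_trans.
    rewrite andbT; have cdp : coprime d p by rewrite coprime_sym prime_coprime.
    have -> : (d %| n`_p^')%N = (d %| n)%N.
      by rewrite -{2}(partnC p n0) Gauss_dvdr // p_part coprimeXr.
    rewrite nE Gauss_dvdr //.
    by case: (boolP (d %| m)%N) => //= /(dvdn_leq m0) dm; rewrite ltnS dm.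
  move=> /andP[/andP[d0 _] _].
  by rewrite natrM lnM ?posrE ?ltr0n // mulrC; ring.
have qn : (0 < n`_p^' <= n)%N by rewrite q0 dvdn_leq ?dvdn_part.
rewrite (sum_divisors_widen _ qn) (sum_moebius q0) /mangoldt n1 /= -/p -p_part.
have -> : (n == n`_p)%N = (n`_p^' == 1)%N.
  rewrite -[X in X == _](partnC p n0) -[X in _ == X]muln1.
  by rewrite eqn_pmul2l ?part_gt0.
by case: ifP; rewrite ?mulr1 ?mulr0 ?oppr0.
Qed.

End ArithmeticFunctions.

(** * Chebyshev's bound, Mertens' theorem and Selberg's formula *)

Section SelbergFormula.
Set Implicit Arguments.
Unset Strict Implicit.
Variable R : realType.
Implicit Types (d e k m n N : nat) (x y : R).

Local Notation mangoldt := (mangoldt R).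
Local Notation moebius := (moebius R).

(** * Elementary bounds for the logarithm *)

Lemma ln_sub_le x y : 0 < x -> 0 < y -> ln y - ln x <= (y - x) / x.
Proof.
move=> x0 y0; rewrite -ln_div ?posrE // mulrBl divff ?gt_eqF //.
have := @le_ln1Dx R (y / x - 1); rewrite subrKC; apply.
by rewrite ltrBrDr addNr divr_gt0.
Qed.

Lemma ln_natS_le n : (0 < n)%N -> ln n.+1%:R - ln n%:R <= n%:R^-1 :> R.
Proof.
move=> n0; apply: le_trans (@ln_sub_le n%:R n.+1%:R _ _) _; rewrite ?ltr0n //.
by rewrite -natrB // subSnn mul1r.
Qed.

Lemma ln_natS_ge n : (0 < n)%N -> n.+1%:R^-1 <= ln n.+1%:R - ln n%:R :> R.
Proof.
move=> n0; have := @ln_sub_le n.+1%:R n%:R; rewrite !ltr0n => /(_ isT n0).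
have -> : (n%:R - n.+1%:R) / n.+1%:R = - n.+1%:R^-1 :> R.
  by rewrite -natr1; field; rewrite natr1 pnatr_eq0.
by move: (n.+1%:R^-1) => z; lra.
Qed.

Lemma ln_nat_ge0 n : 0 <= ln n%:R :> R.
Proof. by case: n => [|n]; [rewrite ln0|rewrite ln_ge0 // ler1n]. Qed.

Lemma ln_le_sqrt x : 0 < x -> ln x <= 2 * Num.sqrt x.
Proof.
move=> x0; have s0 : 0 < Num.sqrt x by rewrite sqrtr_gt0.
rewrite -{1}(sqr_sqrtr (ltW x0)) lnXn //.
by have := ln_sublinear s0; lra.
Qed.

Lemma ln2_le : ln 2 <= 5 / 6 :> R.
Proof.
(* Two factors near 1 keep [ln (1 + t) <= t] sharp enough: 1/2 + 1/3 = 5/6. *)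
have -> : 2 = (1 + 1 / 2) * (1 + 1 / 3) :> R by field.
rewrite lnM ?posrE; [|lra|lra].
have := @le_ln1Dx R (1 / 2); have := @le_ln1Dx R (1 / 3); lra.
Qed.

(** * Chebyshev's function and its upper bound *)

Definition psi N : R := \sum_(1 <= n < N.+1) mangoldt n.

Lemma psi_ge0 N : 0 <= psi N.
Proof. by apply: sumr_ge0 => n _; exact: mangoldt_ge0. Qed.

Lemma psiB m n : (m <= n)%N ->
  psi n - psi m = \sum_(m.+1 <= k < n.+1) mangoldt k.
Proof.
move=> mn; rewrite /psi (@big_cat_nat _ _ _ m.+1 1 n.+1) //=.
by rewrite addrAC subrr add0r.
Qed.

Lemma ln_fact N : ln N`!%:R = \sum_(1 <= k < N.+1) ln k%:R :> R.
Proof.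
elim: N => [|N IH]; first by rewrite fact0 ln1 big_geq.
rewrite factS natrM lnM ?posrE ?ltr0n ?fact_gt0 // IH.
by rewrite [RHS]big_nat_recr //= addrC.
Qed.

Lemma ln_fact_mangoldt N :
  ln N`!%:R = \sum_(1 <= d < N.+1) mangoldt d * (N %/ d)%:R.
Proof.
rewrite ln_fact.
transitivity
  (\sum_(1 <= k < N.+1) \sum_(1 <= d < N.+1 | (d %| k)%N) mangoldt d).
  apply: eq_big_nat => k /andP[k0 kN].
  by rewrite sum_divisors_widen ?k0 // sum_mangoldt_divisors.
rewrite (sum_divisor_pairs (fun d _ => mangoldt d)).
apply: eq_bigr => d _; rewrite sumr_const_nat subSS subn0.
by rewrite mulr_natr.
Qed.

Lemma exchange_hyperbola (f : nat -> nat -> R) N :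
  \sum_(1 <= d < N.+1) \sum_(1 <= e < (N %/ d).+1) f d e =
  \sum_(1 <= e < N.+1) \sum_(1 <= d < (N %/ e).+1) f d e.
Proof.
have widen g d : (0 < d)%N -> \sum_(1 <= e < (N %/ d).+1) g e =
    \sum_(1 <= e < N.+1) (if (d * e <= N)%N then g e else 0) :> R.
  move=> d0; rewrite (big_nat_widen _ _ N.+1) ?ltnS ?leq_div //= -big_mkcond.
  by apply: eq_bigl => e; rewrite ltnS leq_divRL // mulnC.
transitivity (\sum_(1 <= d < N.+1) \sum_(1 <= e < N.+1)
    if (d * e <= N)%N then f d e else 0).
  by apply: eq_big_nat => d /andP[d0 _]; rewrite widen.
rewrite exchange_big /=; apply: eq_big_nat => e /andP[e0 _].
by rewrite widen //; apply: eq_bigr => d _; rewrite mulnC.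
Qed.

Lemma ln_fact_psi N : ln N`!%:R = \sum_(1 <= e < N.+1) psi (N %/ e).
Proof.
rewrite -(exchange_hyperbola (fun d _ => mangoldt d)) ln_fact_mangoldt.
apply: eq_bigr => d _; rewrite sumr_const_nat subSS subn0.
by rewrite mulr_natr.
Qed.

Lemma ln_fact_ge N : (0 < N)%N -> N%:R * ln N%:R - N%:R + 1 <= ln N`!%:R :> R.
Proof.
elim: N => // N IH _; have [->|N0] := posnP N.
  by rewrite factS fact0 muln1 ln1; lra.
rewrite factS natrM lnM ?posrE ?ltr0n ?fact_gt0 //.
have {}IH := IH N0; have h := ln_natS_le N0.
have : N%:R * (ln N.+1%:R - ln N%:R) <= 1 :> R.
  apply: le_trans (ler_wpM2l (ler0n _ _) h) _.
  by rewrite divff ?pnatr_eq0 -?lt0n.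
by rewrite -[in X in X%:R * _ - X%:R]addn1 natrD; lra.
Qed.

Lemma ln_fact_le N : (0 < N)%N ->
  ln N`!%:R <= N%:R * ln N%:R - N%:R + 1 + ln N%:R :> R.
Proof.
elim: N => // N IH _; have [->|N0] := posnP N.
  by rewrite factS fact0 muln1 ln1; lra.
rewrite factS natrM lnM ?posrE ?ltr0n ?fact_gt0 //.
have {}IH := IH N0; have h := ln_natS_ge N0.
have : 1 <= (N%:R + 1) * (ln N.+1%:R - ln N%:R) :> R.
  rewrite natr1; apply: le_trans (ler_wpM2l (ler0n _ _) h).
  by rewrite divff ?pnatr_eq0.
by rewrite -[in X in X%:R * _ - X%:R]addn1 natrD; lra.
Qed.

Lemma bin_le_exp2 n m : ('C(n, m) <= 2 ^ n)%N.
Proof.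
elim: n m => [|n IH] [|m]; rewrite ?bin0 ?expn_gt0 ?bin0n //.
by rewrite binS expnS mul2n -addnn leq_add.
Qed.

(** With M = N %/ 2, the binomial coefficient of N over M is at most 2^N, and (N - M)! is at most N
    times M!. *)
Lemma ln_fact_half_le N : (0 < N)%N ->
  ln N`!%:R - 2 * ln (N %/ 2)`!%:R <= N%:R * ln 2 + ln N%:R :> R.
Proof.
move=> N0; set M := (N %/ 2)%N.
have MN : (M <= N)%N by exact: leq_div.
have hM : ((N - M)`! <= N * M`!)%N.
  have [->|->] : (N - M = M \/ N - M = M.+1)%N by rewrite /M; lia.
    by rewrite leq_pmull.
  by rewrite factS leq_mul2r; apply/orP; right; rewrite /M; lia.
have : (N`! <= 2 ^ N * (N * (M`! * M`!)))%N.
  rewrite -(bin_fact MN) leq_mul ?bin_le_exp2 // [leqRHS]mulnCA.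
  by rewrite leq_mul2l hM orbT.
rewrite -(@ler_nat R) => h.
have : ln N`!%:R <= ln (2 ^ N * (N * (M`! * M`!)))%:R :> R.
  by rewrite ler_ln ?posrE ?ltr0n ?muln_gt0 ?fact_gt0 ?expn_gt0 ?N0.
rewrite !natrM natrX !lnM ?posrE ?mulr_gt0 ?exprn_gt0 ?ltr0n ?fact_gt0 //.
by rewrite lnXn ?ltr0n // -[ln 2 *+ N]mulr_natl; lra.
Qed.

(** By [ln_fact_mangoldt] the coefficient of [mangoldt d] on the right is the parity of [N %/ d]:
    never negative, and 1 for N/2 < d <= N. *)
Lemma psi_half_le N : psi N - psi (N %/ 2) <= ln N`!%:R - 2 * ln (N %/ 2)`!%:R.
Proof.
set M := (N %/ 2)%N; have MN : (M <= N)%N by exact: leq_div.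
have -> : ln M`!%:R = \sum_(1 <= d < N.+1) mangoldt d * (M %/ d)%:R.
  rewrite ln_fact_mangoldt (@big_cat_nat _ _ _ M.+1 1 N.+1) //=.
  rewrite [X in _ + X]big_nat [X in _ + X]big1 ?addr0 // => d /andP[Md _].
  by rewrite divn_small // mulr0.
rewrite ln_fact_mangoldt mulr_sumr -sumrB psiB //.
rewrite [leRHS](@big_cat_nat _ _ _ M.+1 1 N.+1) //= -[leLHS]add0r.
have dE d : (N %/ d)%:R = 2 * (M %/ d)%:R + ((N %/ d) %% 2)%:R :> R.
  by rewrite -natrM -natrD /M divnAC mulnC -divn_eq.
apply: lerD.
  apply: sumr_ge0 => d _; rewrite dE.
  have -> : mangoldt d * (2 * (M %/ d)%:R + ((N %/ d) %% 2)%:R) -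
     2 * (mangoldt d * (M %/ d)%:R) = mangoldt d * ((N %/ d) %% 2)%:R by ring.
  by rewrite mulr_ge0 ?mangoldt_ge0.
apply: ler_sum_nat => d /andP[Md dN].
have d0 : (0 < d)%N by case: d Md {dN}.
have -> : (M %/ d = 0)%N by rewrite divn_small.
have -> : (N %/ d = 1)%N.
  apply/eqP; rewrite eqn_leq -ltnS ltn_divLR // divn_gt0 // andbC -ltnS dN /=.
  by move: Md; rewrite /M; lia.
lra.
Qed.

(** Repeated halving sums [N * ln 2] to 2 N ln 2 <= 5/3 N. The logarithmic errors are absorbed by
    square roots, since 2 + 8 * 3/4 = 8. *)
Lemma psi_le N : psi N <= 5 / 3 * N%:R + 8 * Num.sqrt N%:R.
Proof.
elim/ltn_ind: N => N IH; have [->|N0] := posnP N.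
  by rewrite /psi big_geq // sqrtr0; lra.
have h1 := psi_half_le N; have h2 := ln_fact_half_le N0.
have /IH : (N %/ 2 < N)%N by rewrite ltn_Pdiv.
have N0' : 0 < N%:R :> R by rewrite ltr0n.
have h3 := ln_le_sqrt N0'.
have h4 : N%:R * ln 2 <= N%:R * (5 / 6) :> R.
  by rewrite ler_wpM2l ?ler0n // ln2_le.
have h5 : (N %/ 2)%:R <= N%:R / 2 :> R.
  by rewrite ler_pdivlMr ?ltr0n // -natrM ler_nat leq_trunc_div.
have h6 : Num.sqrt (N %/ 2)%:R <= 3 / 4 * Num.sqrt N%:R :> R.
  have -> : 3 / 4 = Num.sqrt ((3 / 4) ^+ 2) :> R.
    by rewrite sqrtr_sqr ger0_norm //; lra.
  by rewrite -sqrtrM ?sqr_ge0 // ler_wsqrtr //; lra.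
lra.
Qed.

Lemma psi_le10 N : psi N <= 10 * N%:R.
Proof.
have [->|N0] := posnP N; first by rewrite /psi big_geq // mulr0.
have s1 : 1 <= Num.sqrt N%:R :> R by rewrite -{1}sqrtr1 ler_wsqrtr // ler1n.
have := sqr_sqrtr (ler0n R N); have := psi_le N.
set s := Num.sqrt _ in s1 *; set n := N%:R; nra.
Qed.

(** * Mertens' theorem and harmonic sums *)

Definition mertens_sum N : R := \sum_(1 <= d < N.+1) mangoldt d / d%:R.

(** Compares ln N! with [N * mertens_sum N]: rounding N / d down costs at most [mangoldt d] for each
    d, in all at most [psi N], hence at most 10 N. *)
Lemma mertens N : (0 < N)%N -> -1 <= mertens_sum N - ln N%:R <= 10.
Proof.
move=> N0; have N0' : 0 < N%:R :> R by rewrite ltr0n.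
have h1 := ln_fact_ge N0; have h2 := ln_fact_le N0.
have h3 : ln N`!%:R <= N%:R * mertens_sum N.
  rewrite ln_fact_mangoldt mulr_sumr; apply: ler_sum_nat => d /andP[d0 _].
  rewrite mulrCA ler_wpM2l ?mangoldt_ge0 // ler_pdivlMr ?ltr0n //.
  by rewrite -natrM ler_nat leq_trunc_div.
have h4 : N%:R * mertens_sum N <= ln N`!%:R + psi N.
  rewrite ln_fact_mangoldt mulr_sumr -big_split /=.
  apply: ler_sum_nat => d /andP[d0 _].
  rewrite mulrCA -[X in _ + X]mulr1 -mulrDr ler_wpM2l ?mangoldt_ge0 //.
  by rewrite ler_pdivrMr ?ltr0n // natr1 -natrM ler_nat ltnW // ltn_ceil.
have h5 := psi_le10 N.
have h6 : ln N%:R <= N%:R - 1 :> R.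
  by have := @le_ln1Dx R (N%:R - 1); rewrite subrKC; apply; lra.
apply/andP; split; rewrite -(ler_pM2l N0'); lra.
Qed.

Definition harmonic_sum N : R := \sum_(1 <= n < N.+1) n%:R^-1.

Lemma harmonic_sumS N :
  harmonic_sum N.+1 = harmonic_sum N + N.+1%:R^-1.
Proof. by rewrite /harmonic_sum [LHS]big_nat_recr. Qed.

(** Together with [harmonic_sublnS_ge] this brackets Euler's constant between a decreasing and an
    increasing sequence. *)
Lemma harmonic_subln_le m n : (0 < m <= n)%N ->
  harmonic_sum n - ln n%:R <= harmonic_sum m - ln m%:R.
Proof.
case/andP=> m0; elim: n => [|n IH]; first by rewrite leqNgt m0.
rewrite leq_eqVlt => /predU1P[->//|mn]; apply: le_trans (IH mn).
have n0 : (0 < n)%N by exact: leq_trans m0 mn.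
by have := ln_natS_ge n0; rewrite harmonic_sumS; move: (n.+1%:R^-1) => z; lra.
Qed.

Lemma harmonic_sublnS_ge m n : (m <= n)%N ->
  harmonic_sum m - ln m.+1%:R <= harmonic_sum n - ln n.+1%:R.
Proof.
elim: n => [|n IH]; first by rewrite leqn0 => /eqP ->.
rewrite leq_eqVlt => /predU1P[->//|mn]; apply: le_trans (IH mn) _.
have := @ln_natS_le n.+1 isT; rewrite harmonic_sumS.
by move: (n.+1%:R^-1) => z; lra.
Qed.

(** Telescoping of 1 / sqrt d <= 2 (sqrt d - sqrt (d - 1)). *)
Lemma sum_sqrt_div_le N :
  \sum_(1 <= d < N.+1) Num.sqrt (N%:R / d%:R) <= 2 * N%:R :> R.
Proof.
have h n : \sum_(1 <= d < n.+1) (Num.sqrt d%:R)^-1 <= 2 * Num.sqrt n%:R :> R.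
  elim: n => [|n IH]; first by rewrite big_geq // sqrtr0 mulr0.
  rewrite big_nat_recr //=.
  have a0 : 0 < Num.sqrt n.+1%:R :> R by rewrite sqrtr_gt0 ltr0n.
  have b0 : 0 <= Num.sqrt n%:R :> R by exact: sqrtr_ge0.
  have a2 := sqr_sqrtr (ler0n R n.+1); have b2 := sqr_sqrtr (ler0n R n).
  have ba : Num.sqrt n%:R <= Num.sqrt n.+1%:R :> R.
    by rewrite ler_wsqrtr // ler_nat.
  rewrite -[in RHS]natr1 in a2.
  suff : (Num.sqrt n.+1%:R)^-1 <= 2 * (Num.sqrt n.+1%:R - Num.sqrt n%:R) :> R.
    by lra.
  rewrite -div1r ler_pdivrMr //.
  by move: (Num.sqrt n.+1%:R) (Num.sqrt n%:R) a0 b0 a2 b2 ba => a b; nra.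
under eq_bigr do rewrite sqrtrM ?ler0n // sqrtrV ?ler0n //.
rewrite -mulr_sumr; apply: le_trans (ler_wpM2l (sqrtr_ge0 _) (h N)) _.
by rewrite mulrCA -expr2 sqr_sqrtr.
Qed.

Lemma ln_sqr_le_sqrt y : 1 <= y -> ln y * (1 + ln y) <= 16 * Num.sqrt y.
Proof.
move=> y1; have y0 : 0 <= y by lra.
(* With y = s^4 one has ln y <= 4 (s - 1), so the square of ln y is at most of order s^2 = sqrt
   y. *)
set s := Num.sqrt (Num.sqrt y).
have sE : s ^+ 2 = Num.sqrt y by rewrite sqr_sqrtr ?sqrtr_ge0.
have s1 : 1 <= s by rewrite -[1]sqrtr1 ler_wsqrtr // -[1]sqrtr1 ler_wsqrtr.
have yE : y = s ^+ 4 by rewrite (exprM s 2 2) sE sqr_sqrtr.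
have : ln y <= 4 * (s - 1).
  rewrite yE lnXn; last lra.
  by have := @le_ln1Dx R (s - 1); rewrite subrKC => /(_ ltac:(lra)); lra.
have := ln_ge0 y1; rewrite -sE; move: (ln y) => l; nra.
Qed.

(** * Selberg's formula by Moebius inversion of the remainder *)

Section Remainder.
Variable N : nat.
Hypothesis N0 : (0 < N)%N.

(* This stands for Euler's constant: every estimate below is uniform in N. *)
Let gam := harmonic_sum N - ln N%:R.

(** The remainder of [psi], shifted by a constant chosen so that in sums over the multiples of d the
    terms of order N / d cancel. *)
Let F k := psi (N %/ k) - N%:R / k%:R + gam + 1.

Let gam_bounds : 0 <= gam <= 1.
Proof.
have := @harmonic_subln_le 1 N; rewrite N0 => /(_ isT).
have := @harmonic_sublnS_ge 0 N (leq0n _); have := ln_natS_ge N0.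
rewrite ln1 /harmonic_sum big_geq // big_nat1 invr1 -/(harmonic_sum N) /gam.
have : 0 <= N.+1%:R^-1 :> R by [].
by move: (N.+1%:R^-1) => z ? ? ? ?; apply/andP; split; lra.
Qed.

(** The values of [psi] add up to ln m!, near m ln m - m, and the terms N / (d e) to y times a
    harmonic sum, near y (ln m + gam). The shift [gam + 1] cancels what is left, up to a
    logarithm. *)
Let sum_F_le d : (0 < d <= N)%N ->
  `|\sum_(1 <= e < (N %/ d).+1) F (d * e)| <= 1 + ln (N%:R / d%:R).
Proof.
case/andP=> d0 dN; set m := (N %/ d)%N; set y : R := N%:R / d%:R.
have m0 : (0 < m)%N by rewrite divn_gt0.
have d0' : 0 < d%:R :> R by rewrite ltr0n.
have my : m%:R <= y by rewrite ler_pdivlMr // -natrM ler_nat leq_trunc_div.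
have ym : y <= m%:R + 1.
  by rewrite ler_pdivrMr // natr1 -natrM ler_nat ltnW // ltn_ceil.
have -> : \sum_(1 <= e < m.+1) F (d * e) =
    ln m`!%:R - y * harmonic_sum m + (gam + 1) * m%:R.
  rewrite /F; under eq_bigr do rewrite -addrA.
  rewrite big_split sumrB /= sumr_const_nat subSS subn0.
  rewrite ln_fact_psi mulr_sumr; congr (_ - _ + _).
    by apply: eq_bigr => e _; rewrite divnMA.
    by apply: eq_bigr => e _; rewrite natrM invfM mulrA.
  by rewrite mulr_natr.
have mN : (0 < m <= N)%N by rewrite m0 leq_div.
have mN' : (m <= N)%N by rewrite leq_div.
have h1 := ln_fact_ge m0; have h2 := ln_fact_le m0.
have h3 := harmonic_subln_le mN; have h4 := harmonic_sublnS_ge mN'.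
have h5 := ln_natS_le m0; have h6 := ln_natS_ge N0.
have N1 : 0 <= N.+1%:R^-1 :> R by [].
have h7 := @harmonic_subln_le 1 m; rewrite m0 in h7; have {h7} := h7 isT.
rewrite ln1 {2}/harmonic_sum big_nat1 invr1 => h7.
have m0' : 0 < m%:R :> R by rewrite ltr0n.
have lnmy : ln m%:R <= ln y.
  by rewrite ler_ln ?posrE //; exact: lt_le_trans my.
have gE : gam = harmonic_sum N - ln N%:R by [].
have g1 : 0 <= m%:R * (harmonic_sum m - ln m%:R - gam).
  by rewrite mulr_ge0 //; lra.
have g2 : m%:R * (harmonic_sum m - ln m%:R - gam) <= 1.
  have : harmonic_sum m - ln m%:R - gam <= m%:R^-1.
    by move: (m%:R^-1) (N.+1%:R^-1) h5 h6 N1 => a b; lra.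
  by rewrite -(ler_pM2l m0') divff // gt_eqF.
have H0 : 0 <= harmonic_sum m by apply: sumr_ge0.
have g3 : 0 <= (y - m%:R) * harmonic_sum m by rewrite mulr_ge0 //; lra.
have g4 : (y - m%:R) * harmonic_sum m <= harmonic_sum m.
  by rewrite -[leRHS]mul1r ler_wpM2r //; lra.
by rewrite ler_norml; apply/andP; split; lra.
Qed.

(** Grouped by k = d e, the weights add up over the divisors d of k to [mangoldt k], plus [ln N]
    when k = 1, by the two divisor sums of [moebius]. *)
Let convolution_identity :
  \sum_(1 <= d < N.+1) \sum_(1 <= e < (N %/ d).+1)
     moebius d * (ln N%:R - ln d%:R) * F (d * e) =
  F 1 * ln N%:R + \sum_(1 <= k < N.+1) mangoldt k * F k.
Proof.
rewrite -(sum_divisor_pairs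
  (fun d e => moebius d * (ln N%:R - ln d%:R) * F (d * e))).
have -> : F 1 * ln N%:R = \sum_(1 <= k < N.+1) (k == 1)%N%:R * ln N%:R * F k.
  rewrite big_ltn // eqxx big_nat big1 ?addr0; first by rewrite mul1r mulrC.
  by move=> k /andP[k1 _]; rewrite gtn_eqF // !mul0r.
rewrite -big_split /=; apply: eq_big_nat => k /andP[k0 kN].
rewrite -mulrDl -(sum_moebius R k0) -[mangoldt k]opprK -sum_moebius_ln //.
rewrite mulr_suml -sumrB mulr_suml sum_divisors_widen ?k0 //.
by apply: eq_bigr => d dk; rewrite -mulrBr mulnC divnK.
Qed.

(** The inner sums are logarithmic by [sum_F_le], so the term of d is at most 16 sqrt (N / d). *)
Let convolution_le :
  `|F 1 * ln N%:R + \sum_(1 <= k < N.+1) mangoldt k * F k| <= 32 * N%:R.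
Proof.
rewrite -convolution_identity; apply: le_trans (ler_norm_sum _ _ _) _.
have -> : 32 * N%:R = 16 * (2 * N%:R) :> R by ring.
apply: le_trans (ler_wpM2l _ (sum_sqrt_div_le N)); last lra.
rewrite mulr_sumr; apply: ler_sum_nat => d /andP[d0 dN].
rewrite -mulr_sumr normrM normrM; have d0' : 0 < d%:R :> R by rewrite ltr0n.
have y1 : 1 <= N%:R / d%:R :> R by rewrite ler_pdivlMr // mul1r ler_nat.
have l0 := ln_ge0 y1; rewrite -ln_div ?posrE ?ltr0n //.
apply: le_trans (ln_sqr_le_sqrt y1).
rewrite -mulrA -[leRHS]mul1r ler_pM ?normr_moebius //.
by rewrite (ger0_norm l0) ler_wpM2l // sum_F_le // d0.
Qed.

(** Expanding [F], one main term N ln N comes from [F 1] and the other from Mertens' theorem; the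
    shift contributes only O(N). *)
Lemma selberg_nat :
  `|psi N * ln N%:R + \sum_(1 <= k < N.+1) mangoldt k * psi (N %/ k)
    - 2 * N%:R * ln N%:R| <= 65 * N%:R.
Proof.
have := convolution_le; have /andP[g0 g1] := gam_bounds.
have /andP[m1 m2] := mertens N0; have p0 := psi_ge0 N; have p1 := psi_le10 N.
have l0 := ln_nat_ge0 N; have N0' : 0 < N%:R :> R by rewrite ltr0n.
have l1 := ltW (ln_sublinear N0').
have -> : \sum_(1 <= k < N.+1) mangoldt k * F k =
   \sum_(1 <= k < N.+1) mangoldt k * psi (N %/ k) - N%:R * mertens_sum N
   + (gam + 1) * psi N.
  rewrite mulr_sumr mulr_sumr -sumrB -big_split /=.
  by apply: eq_bigr => k _; rewrite /F; ring.
rewrite /F divn1 divr1; set S := \sum_(1 <= k < _) _.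
have a1 : 0 <= (gam + 1) * ln N%:R by rewrite mulr_ge0 //; lra.
have a2 : (gam + 1) * ln N%:R <= 2 * N%:R.
  by apply: ler_pM => //; lra.
have a3 : 0 <= (gam + 1) * psi N by rewrite mulr_ge0 //; lra.
have a4 : (gam + 1) * psi N <= 2 * (10 * N%:R).
  by apply: ler_pM => //; lra.
have a5 : N%:R * (-1) <= N%:R * (mertens_sum N - ln N%:R).
  by rewrite ler_pM2l.
have a6 : N%:R * (mertens_sum N - ln N%:R) <= N%:R * 10 by rewrite ler_pM2l.
by rewrite !ler_norml => /andP[? ?]; apply/andP; split; lra.
Qed.

End Remainder.

End SelbergFormula.

(** * Short intervals contain prime powers *)

Section ErdosGapTheorem.
Set Implicit Arguments.
Unset Strict Implicit.
Variable R : realType.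
Implicit Types (k n N : nat) (x y z : R).

Local Notation mangoldt := (mangoldt R).
Local Notation truncn := Num.truncn.

(** * Summatory functions of a real variable *)

Definition cumul (w : nat -> R) x := \sum_(1 <= n < (truncn x).+1) w n.

Lemma cumulB (w : nat -> R) y z : y <= z ->
  cumul w z - cumul w y = \sum_((truncn y).+1 <= n < (truncn z).+1) w n.
Proof.
move=> yz; rewrite /cumul (@big_cat_nat _ _ _ (truncn y).+1 1) //=.
  by rewrite addrAC subrr add0r.
by rewrite ltnS le_truncn.
Qed.

Lemma le_cumul (w : nat -> R) y z : (forall n, (0 < n)%N -> 0 <= w n) ->
  y <= z -> cumul w y <= cumul w z.
Proof.
move=> w0 yz; rewrite -subr_ge0 cumulB // big_nat sumr_ge0 // => n /andP[yn _].
by apply: w0; apply: leq_ltn_trans yn.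
Qed.

Lemma truncn_window n y z : 0 <= y -> 0 <= z ->
  ((truncn y).+1 <= n < (truncn z).+1)%N = (y < n%:R <= z).
Proof. by move=> y0 z0; rewrite truncn_lt_nat // ltnS truncn_ge_nat. Qed.

Lemma truncn_divn x k : 0 <= x -> (0 < k)%N ->
  truncn (x / k%:R) = (truncn x %/ k)%N.
Proof.
move=> x0 k0; have k0' : 0 < k%:R :> R by rewrite ltr0n.
apply: truncn_def; have /andP[h1 h2] := truncn_itv x0; apply/andP; split.
  rewrite ler_pdivlMr //; apply: le_trans h1.
  by rewrite -natrM ler_nat leq_trunc_div.
rewrite ltr_pdivrMr //; apply: lt_le_trans h2 _.
by rewrite -natrM ler_nat ltn_ceil.
Qed.

Definition chebyshev x := cumul mangoldt x.

Lemma chebyshevE x : chebyshev x = psi R (truncn x).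
Proof. by []. Qed.

Lemma chebyshev_ge0 x : 0 <= chebyshev x.
Proof. exact: psi_ge0. Qed.

Lemma le_chebyshev : {homo chebyshev : x y / x <= y}.
Proof. by move=> x y xy; apply: le_cumul => // n _; exact: mangoldt_ge0. Qed.

Lemma chebyshev_lt2 x : x < 2 -> chebyshev x = 0.
Proof.
move=> x2; rewrite /chebyshev /cumul big_nat big1 // => n /andP[n0].
rewrite ltnS => nx; have n1 : (n < 2)%N.
  have [x0|x0] := leP 0 x; last by rewrite truncn_floor leNgt x0 /= in nx; lia.
  by rewrite -(@ltr_nat R); apply: le_lt_trans x2; rewrite -truncn_ge_nat.
by have -> : n = 1%N by lia.
Qed.

Lemma chebyshev_le x : 0 <= x -> chebyshev x <= 5 / 3 * x + 8 * Num.sqrt x.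
Proof.
move=> x0; have /andP[h _] := truncn_itv x0.
apply: le_trans (psi_le _ _) _; apply: lerD; first by rewrite ler_wpM2l //; lra.
by rewrite ler_wpM2l ?ler_wsqrtr.
Qed.

Lemma chebyshev_le10 x : 0 <= x -> chebyshev x <= 10 * x.
Proof.
move=> x0; have /andP[h _] := truncn_itv x0.
by apply: le_trans (psi_le10 _ _) _; rewrite ler_wpM2l.
Qed.

Lemma ln_truncn x : 1 <= x ->
  ln (truncn x)%:R <= ln x <= ln (truncn x)%:R + (truncn x)%:R^-1.
Proof.
move=> x1; have x0 : 0 <= x by lra.
have /andP[h1 h2] := truncn_itv x0.
have N0 : 0 < (truncn x)%:R :> R by rewrite ltr0n truncn_gt0.
rewrite ler_ln ?posrE //; last exact: lt_le_trans h1.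
rewrite h1 /= -lerBlDl; apply: le_trans (ln_sub_le N0 _) _.
  exact: lt_le_trans h1.
rewrite -[leRHS]mul1r ler_wpM2r ?invr_ge0 //.
by rewrite lerBlDl natr1 ltW.
Qed.

Definition mertens_real x := cumul (fun n => mangoldt n / n%:R) x.

Lemma mertens_realP x : 1 <= x -> -12 <= mertens_real x - ln x <= 12.
Proof.
move=> x1; have N0 : (0 < truncn x)%N by rewrite truncn_gt0.
have /andP[h1 h2] := mertens R N0; have /andP[h3 h4] := ln_truncn x1.
have : (truncn x)%:R^-1 <= 1 :> R by rewrite invf_le1 ?ltr0n // ler1n.
rewrite -[mertens_real x]/(mertens_sum R (truncn x)).
move: (_^-1) h4 => z h4 z1.
by apply/andP; split; lra.
Qed.

Definition selberg_sum x :=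
  cumul (fun k => mangoldt k * chebyshev (x / k%:R)) x.

(** The added terms have x / k < 1, where [chebyshev] vanishes. *)
Lemma selberg_sum_widen x y : 0 <= x <= y ->
  selberg_sum x = cumul (fun k => mangoldt k * chebyshev (x / k%:R)) y.
Proof.
move=> /andP[x0 xy]; apply/esym/eqP; rewrite -subr_eq0 cumulB //.
rewrite big_nat big1 // => k; rewrite truncn_window //; last lra.
move=> /andP[xk _]; rewrite chebyshev_lt2 ?mulr0 //.
have k0 : 0 < k%:R :> R by lra.
by rewrite ltr_pdivrMr //; lra.
Qed.

Lemma le_selberg_sum x y : 0 <= x <= y -> selberg_sum x <= selberg_sum y.
Proof.
move=> xy; rewrite (selberg_sum_widen xy) /selberg_sum /cumul.
apply: ler_sum_nat => k /andP[k0 _]; rewrite ler_wpM2l ?mangoldt_ge0 //.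
apply: le_chebyshev; rewrite ler_wpM2r ?invr_ge0 //.
by case/andP: xy.
Qed.

Lemma selberg x : 1 <= x ->
  `|chebyshev x * ln x + selberg_sum x - 2 * x * ln x| <= 100 * x.
Proof.
move=> x1; have x0 : 0 <= x by lra.
have N0 : (0 < truncn x)%N by rewrite truncn_gt0.
have := selberg_nat R N0; have /andP[h1 h2] := ln_truncn x1.
have -> : \sum_(1 <= k < (truncn x).+1) mangoldt k * psi R (truncn x %/ k) =
  selberg_sum x.
  apply: eq_big_nat => k /andP[k0 _].
  by rewrite chebyshevE truncn_divn.
rewrite -chebyshevE; have p0 := chebyshev_ge0 x.
have /andP[h3 h4] := truncn_itv x0; have p1 := psi_le10 R (truncn x).
rewrite -chebyshevE in p1.
have N0' : 0 < (truncn x)%:R :> R by rewrite ltr0n.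
have h5 : (truncn x)%:R * (ln x - ln (truncn x)%:R) <= 1.
  rewrite -[leRHS](divff (lt0r_neq0 N0')) ler_pM2l //; lra.
have N1 : 1 <= (truncn x)%:R :> R by rewrite ler1n.
rewrite -natr1 in h4; have l0 := ln_ge0 x1.
have x0' : 0 < x by lra.
have l1 := ln_sublinear x0'.
move: (truncn x)%:R h1 h2 h3 h4 h5 p1 N0' N1 => n h1 h2 h3 h4 h5 p1 N0' N1.
have a1 : 0 <= chebyshev x * (ln x - ln n) by rewrite mulr_ge0 //; lra.
have a2 : chebyshev x * (ln x - ln n) <= 10.
  apply: le_trans (ler_wpM2r _ p1) _; first lra.
  by rewrite -mulrA; lra.
have a3 : 0 <= (x - n) * ln x by rewrite mulr_ge0 //; lra.
have a4 : (x - n) * ln x <= ln x by rewrite -[leRHS]mul1r ler_wpM2r //; lra.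
have a5 : 0 <= n * (ln x - ln n) by rewrite mulr_ge0 //; lra.
by rewrite !ler_norml => /andP[? ?]; apply/andP; split; lra.
Qed.

(** * Windows of bounded and of positive density *)

Definition window_bound (tau B : R) := forall y z, 0 <= y <= z ->
  chebyshev z - chebyshev y <= 2 * (z - y) + tau * z + B.

(** Subtract Selberg's formula at y from that at z and drop the increment of [selberg_sum], which is
    nonnegative. Division by [ln z] brings the O(z) errors below [tau * z] for large z; small z are
    covered by B. *)
Lemma chebyshev_window_le (tau : R) : 0 < tau ->
  exists2 B, 0 <= B & window_bound tau B.
Proof.
(* 202 is 100 + 100 from Selberg's formula at z and y, plus 2 from 2 y (ln z - ln y) <= 2 (z -
   y). *)
move=> tau0; pose c := 202 / tau.
have c0 : 0 < c by rewrite divr_gt0.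
exists (10 * expR c) => [|y z /andP[y0 yz]].
  by rewrite mulr_ge0 ?expR_ge0.
have z0 : 0 <= z by lra.
have tz0 : 0 <= tau * z by rewrite mulr_ge0 // ltW.
have [zc|zc] := leP z (expR c).
  by have := chebyshev_le10 z0; have := chebyshev_ge0 y; lra.
have e0 : 0 < 10 * expR c by rewrite mulr_gt0 ?expR_gt0.
have e1 : 1 < expR c by rewrite expR_gt1.
(* Nothing is counted below 2, so y < 1 may be raised to 1. *)
wlog y1 : y y0 yz / 1 <= y.
  have [y1 h|y1 /(_ 1)] := leP 1 y; first exact: h.
  rewrite (@chebyshev_lt2 y) 1?(@chebyshev_lt2 1); [|lra..].
  by have := chebyshev_ge0 z => ? /(_ ltac:(lra) ltac:(lra) ltac:(lra)); lra.
have z0' : 0 < z by lra.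
have lz : c < ln z by rewrite -ltr_expR lnK ?posrE.
have := @selberg y y1; have := @selberg z ltac:(lra).
rewrite !ler_norml => /andP[_ hz] /andP[hy _].
have hs : selberg_sum y <= selberg_sum z by apply: le_selberg_sum; rewrite y0.
have lyz : ln y <= ln z by rewrite ler_ln ?posrE //; lra.
have a1 : chebyshev y * ln y <= chebyshev y * ln z.
  by rewrite ler_wpM2l ?chebyshev_ge0.
have a2 : y * (ln z - ln y) <= z - y.
  have y0' : 0 < y by lra.
  apply: le_trans (ler_wpM2l y0 (ln_sub_le y0' z0')) _.
  by rewrite mulrC divfK // gt_eqF.
have a3 : 202 * z <= tau * z * ln z.
  rewrite mulrAC ler_wpM2r // -ler_pdivrMl // mulrC; exact: ltW.
have lz0 : 0 < ln z by lra.
suff : (chebyshev z - chebyshev y) * ln z <= (2 * (z - y) + tau * z) * ln z.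
  by rewrite ler_pM2r //; lra.
lra.
Qed.

Definition positive_density (lam : R) := exists2 del : R, 0 < del &
  exists y0, forall y, y0 <= y -> del * y <= chebyshev (lam * y) - chebyshev y.

(** By Mertens' theorem, with error 12 at either end, the sum of [mangoldt n / n] over ]y, lam y] is
    at least 25 - 24 = 1, and 1 / n < 1 / y there. *)
Lemma positive_density_large (lam : R) : expR 25 <= lam -> positive_density lam.
Proof.
move=> lam25; exists 1 => //; exists 1 => y y1; rewrite mul1r.
have lam1 : 1 <= lam by apply: le_trans lam25; rewrite ltW // expR_gt1.
have ly : y <= lam * y by rewrite -[leLHS]mul1r ler_wpM2r //; lra.
have y0 : 0 < y by lra.
have := mertens_realP y1; have := @mertens_realP (lam * y) ltac:(lra).
rewrite lnM ?posrE; [|lra..].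
have lnlam : 25 <= ln lam by rewrite -ler_expR lnK ?posrE //; lra.
move=> /andP[h1 _] /andP[_ h2].
have : y * (mertens_real (lam * y) - mertens_real y) <=
       chebyshev (lam * y) - chebyshev y.
  rewrite !cumulB // mulr_sumr; apply: ler_sum_nat => n; rewrite truncn_window.
  - move=> /andP[yn _]; rewrite mulrCA -[leRHS]mulr1.
    rewrite ler_wpM2l ?mangoldt_ge0 // ler_pdivrMr ?mul1r ?ltW //; lra.
  - exact: ltW.
  - lra.
apply: le_trans; rewrite -[leLHS]mulr1 ler_wpM2l //; lra.
Qed.

Lemma bernoulli_unbounded (eta M : R) :
  0 < eta -> exists j, M <= (1 + eta) ^+ j.
Proof.
move=> eta0; exists (truncn (M / eta)).+1.
have h : M / eta < (truncn (M / eta)).+1%:R by exact: truncnS_gt.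
move: h; move: _.+1 => j; rewrite ltr_pdivrMr // => h.
apply: le_trans (ltW h) _; elim: j {h} => [|j IH]; first by rewrite mul0r expr0.
have e1 : 1 <= (1 + eta) ^+ j by rewrite exprn_ege1 //; lra.
rewrite exprS -natr1; nra.
Qed.

(** Along lam0 (1 + eta)^j the density is positive for large j by [positive_density_large], so
    somewhere a failure is followed by a success. *)
Lemma maximal_not_positive_density (lam0 eta : R) :
  1 < lam0 -> 0 < eta -> ~ positive_density lam0 ->
  exists lam, [/\ lam0 <= lam, ~ positive_density lam &
    positive_density (lam * (1 + eta))].
Proof.
move=> lam1 eta0 bad0; apply/not_existsP => hn.
have bad j : ~ positive_density (lam0 * (1 + eta) ^+ j).
  elim: j => [|j IH]; first by rewrite expr0 mulr1.
  rewrite exprSr mulrA => gd; apply: (hn (lam0 * (1 + eta) ^+ j)); split=> //.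
  rewrite -[leLHS]mulr1 ler_wpM2l //; first lra.
  by rewrite exprn_ege1 //; lra.
have [j hj] := @bernoulli_unbounded eta (expR 25) eta0.
apply: (bad j); apply: positive_density_large; apply: le_trans hj _.
rewrite -[leLHS]mul1r ler_wpM2r //; last lra.
by rewrite exprn_ge0 //; lra.
Qed.

(* By how much psi falls short of window_bound on ]x / n, lam * x / n]. *)
Definition defect (lam tau B : R) x n :=
  (2 * (lam - 1) + tau * lam) * (x / n%:R) + B -
  (chebyshev (lam * (x / n%:R)) - chebyshev (x / n%:R)).

Lemma defect_ge0 (lam tau B : R) x n : 1 < lam -> window_bound tau B ->
  0 <= x -> 0 <= defect lam tau B x n.
Proof.
move=> lam1 windowB x0; rewrite /defect.
have : 0 <= x / n%:R by rewrite divr_ge0.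
move: (x / n%:R) => y y0; have yly : y <= lam * y.
  by rewrite -[leLHS]mul1r ler_wpM2r //; lra.
by have := @windowB y (lam * y); rewrite y0 yly => /(_ isT); lra.
Qed.

(** By Mertens' theorem and Selberg's formula the weighted sum of defects is, up to O(x), at most
    tau lam x ln x plus ln x times the increment of [chebyshev] on ]x, lam x]. As [lam] lacks
    positive density, this increment is small for arbitrarily large x. *)
Lemma small_defect (lam tau B theta x0 : R) :
  1 < lam -> 0 <= B -> 0 < tau -> ~ positive_density lam -> tau * lam < theta ->
  exists2 x, x0 <= x & 1 <= x /\
    cumul (fun n => mangoldt n * defect lam tau B x n) (lam * x) <=
    theta * x * ln x.
Proof.
move=> lam1 B0 tau0 bad taut; pose kap := (theta - tau * lam) / 2.
have kap0 : 0 < kap by rewrite /kap; lra.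
(* Here theta = tau lam + 2 kap: one [kap] pays for the sparse window, the other for [K * x], which
   collects the terms of order x. *)
pose K := (2 * (lam - 1) + tau * lam) * (ln lam + 12) + 10 * B * lam +
  100 * (lam + 1) + 10 * lam * ln lam.
have [x [xx0 x1 xK xg]] : exists x, [/\ x0 <= x, 1 <= x, expR (K / kap) <= x &
    chebyshev (lam * x) - chebyshev x <= kap * x].
  apply: contrapT => hn; apply: bad; exists kap => //.
  exists (Num.max x0 (Num.max 1 (expR (K / kap)))) => y.
  rewrite !ge_max => /andP[h1 /andP[h2 h3]].
  have [//|h4] := leP (kap * y) (chebyshev (lam * y) - chebyshev y).
  by case: hn; exists y; split=> //; exact: ltW.
have x0' : 0 < x by lra.
have xlx : x <= lam * x by rewrite -[leLHS]mul1r ler_wpM2r //; lra.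
exists x => //; split=> //.
have -> : cumul (fun n => mangoldt n * defect lam tau B x n) (lam * x) =
    (2 * (lam - 1) + tau * lam) * x * mertens_real (lam * x) +
    B * chebyshev (lam * x) - (selberg_sum (lam * x) - selberg_sum x).
  rewrite (@selberg_sum_widen x (lam * x)) ?xlx ?andbT ?ltW //.
  rewrite /selberg_sum /mertens_real /chebyshev /cumul !mulr_sumr -!sumrB.
  rewrite -big_split -sumrB /=; apply: eq_bigr => n _.
  by rewrite /defect (mulrA lam x) /chebyshev /cumul; ring.
have lx1 : 1 <= lam * x by lra.
have lxE : ln (lam * x) = ln lam + ln x by rewrite lnM ?posrE //; lra.
have /andP[_ m2] := mertens_realP lx1.
have h10 := @chebyshev_le10 (lam * x) ltac:(lra).
have := selberg x1; have := selberg lx1; rewrite !lxE !ler_norml.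
move=> /andP[s1 _] /andP[_ s2].
have ll0 : 0 < ln lam by rewrite ln_gt0.
have lx0 : 0 <= ln x by rewrite ln_ge0.
have Kx : K * x <= kap * x * ln x.
  have : K / kap <= ln x by rewrite -ler_expR lnK ?posrE.
  by rewrite ler_pdivrMr // => h; rewrite mulrAC ler_wpM2r ?(ltW x0') // mulrC.
have a1 : (2 * (lam - 1) + tau * lam) * x * mertens_real (lam * x) <=
    (2 * (lam - 1) + tau * lam) * x * (ln lam + ln x + 12).
  rewrite ler_wpM2l //; last by rewrite lxE in m2; lra.
  by rewrite mulr_ge0 ?ltW // addr_gt0 ?mulr_gt0 //; lra.
have a2 : B * chebyshev (lam * x) <= B * (10 * (lam * x)).
  by rewrite ler_wpM2l.
have a3 : (chebyshev (lam * x) - chebyshev x) * ln x <= kap * x * ln x.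
  by rewrite ler_wpM2r.
have a4 : chebyshev (lam * x) * ln lam <= 10 * (lam * x) * ln lam.
  by rewrite ler_wpM2r // ltW.
have a5 : 0 <= lam * x * ln lam by rewrite !mulr_ge0 //; lra.
have thE : theta = tau * lam + 2 * kap by rewrite /kap; field.
rewrite thE; rewrite /K in Kx.
lra.
Qed.

(** Pigeonhole over the blocks ]Q^i, Q^(i+1)] up to sqrt x, about ln x / (2 ln Q) in number.
    Stopping at sqrt x keeps x / n large on the block. *)
Lemma light_block (Q : R) (i0 : nat) : 1 < Q ->
  exists X, forall (w : nat -> R) (x y theta : R),
    (forall n, (0 < n)%N -> 0 <= w n) -> 0 < theta -> X <= x -> 1 < x ->
    x <= y -> cumul w y <= theta * x * ln x ->
    exists i, [/\ (i0 <= i)%N, Q ^+ i.+1 <= Num.sqrt x &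
      cumul w (Q ^+ i.+1) - cumul w (Q ^+ i) <= 4 * theta * ln Q * x].
Proof.
move=> Q1; have lQ : 0 < ln Q by rewrite ln_gt0.
(* This makes t >= 2 (1 + i0), so skipping i0 blocks and rounding t down loses at most half of the
   blocks; hence the 4 in the bound. *)
exists (expR (4 * (1 + i0%:R) * ln Q)) => w x y theta w0 th0 xX x1 xy wy.
have x0 : 0 < x by lra.
have lx : 4 * (1 + i0%:R) * ln Q <= ln x by rewrite -ler_expR lnK ?posrE.
have lx0 : 0 < ln x by rewrite ln_gt0.
pose t := ln x / (2 * ln Q); pose I := truncn t.
have t0 : 0 <= t by rewrite divr_ge0 // ltW // mulr_gt0.
have /andP[It tI] := truncn_itv t0; rewrite -/I -natr1 in It tI.
have tE : t * (2 * ln Q) = ln x by rewrite divfK // gt_eqF // mulr_gt0.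
have t4 : 2 * (1 + i0%:R) <= t.
  by rewrite -(@ler_pM2r _ (2 * ln Q)) ?mulr_gt0 // tE; lra.
have i0I : (i0 < I)%N.
  rewrite -(@ltr_nat R); have : 0 <= i0%:R :> R by []. lra.
have Qx i : (i <= I)%N -> Q ^+ i <= Num.sqrt x.
  move=> iI; rewrite -ler_ln ?posrE ?exprn_gt0 ?sqrtr_gt0 //; last lra.
  have -> : ln (Num.sqrt x) = ln x / 2.
    have := lnXn 2 (_ : 0 < Num.sqrt x); rewrite sqrtr_gt0 => /(_ x0).
    by rewrite sqr_sqrtr ?ltW // => ->; rewrite mulr2n; field.
  rewrite lnXn; last lra.
  have -> : ln x / 2 = t * ln Q by rewrite -tE; field.
  rewrite -mulr_natl ler_wpM2r ?(ltW lQ) //; apply: le_trans It.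
  by rewrite ler_nat.
have sx : Num.sqrt x <= x.
  have s1 : 1 <= Num.sqrt x by rewrite -[1]sqrtr1 ler_wsqrtr // ltW.
  by have := sqr_sqrtr (ltW x0); move: (Num.sqrt x) s1 => s; nra.
apply: contrapT => hn; set c := 4 * theta * ln Q * x in hn.
have c0 : 0 < c by rewrite /c !mulr_gt0.
have hb i : (i0 <= i < I)%N -> c < cumul w (Q ^+ i.+1) - cumul w (Q ^+ i).
  move=> /andP[h1 h2]; rewrite ltNge; apply/negP => h3; apply: hn.
  by exists i; split=> //; exact: Qx.
have hsum j : (i0 <= j <= I)%N -> (j - i0)%:R * c <=
    cumul w (Q ^+ j) - cumul w (Q ^+ i0).
  elim: j => [|j IH] /andP[].
    by rewrite leqn0 => /eqP -> _; rewrite subnn mul0r subrr.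
  rewrite leq_eqVlt => /predU1P[<- _|]; first by rewrite subnn mul0r subrr.
  rewrite ltnS => h1 h2; have := IH; rewrite h1 ltnW // => /(_ isT).
  have := hb j; rewrite h1 h2 => /(_ isT).
  by rewrite subSn // -natr1; lra.
have := hsum I; rewrite leqnn ltnW // => /(_ isT).
rewrite natrB ?(ltnW i0I) // => h.
have h0 : 0 <= cumul w (Q ^+ i0).
  by rewrite /cumul big_nat sumr_ge0 // => n /andP[/w0].
have hI : cumul w (Q ^+ I) <= cumul w y.
  by apply: le_cumul => //; apply: le_trans xy; exact: le_trans (Qx _ _) sx.
have : ln x < 4 * (I%:R - i0%:R) * ln Q.
  by rewrite -tE mulrA ltr_pM2r //; lra.
rewrite -(@ltr_pM2l _ (theta * x)) ?mulr_gt0 //.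
rewrite /c in h; lra.
Qed.

(** Otherwise every defect on ]v, mu v] exceeds sig x / (mu v), and the mass del v of the window
    makes the weighted sum twice the allowed amount. *)
Lemma window_pick (lam tau B x sig mu v del : R) :
  1 < lam -> window_bound tau B -> 0 < x -> 0 < sig -> 1 < mu -> 0 < v ->
  0 < del -> del * v <= chebyshev (mu * v) - chebyshev v ->
  let w n := mangoldt n * defect lam tau B x n in
  cumul w (mu * v) - cumul w v <= sig * x * del / (2 * mu) ->
  exists n, [/\ v < n%:R, n%:R <= mu * v &
    defect lam tau B x n <= sig * (x / n%:R)].
Proof.
move=> lam1 HB x0 sig0 mu1 v0 del0 hv w hw; apply: contrapT => hn.
have mu0 : 0 < mu by exact: lt_trans mu1.
have mv0 : 0 < mu * v by exact: mulr_gt0.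
have vmu : v <= mu * v by rewrite -[leLHS]mul1r ler_wpM2r // ltW.
have c0 : 0 < sig * x / (mu * v) by rewrite divr_gt0 // mulr_gt0.
have h1 : sig * x / (mu * v) * (chebyshev (mu * v) - chebyshev v) <=
          cumul w (mu * v) - cumul w v.
  rewrite !cumulB // mulr_sumr; apply: ler_sum_nat => n.
  rewrite truncn_window ?(ltW v0) ?(ltW mv0) // => /andP[nv nm].
  rewrite /w mulrC ler_wpM2l ?mangoldt_ge0 //.
  rewrite leNgt; apply/negP => h; apply: hn; exists n; split=> //.
  apply: le_trans (ltW h) _; rewrite -[leLHS]mulrA ler_pM2l // ler_pM2l //.
  by rewrite lef_pV2 ?posrE //; exact: lt_trans nv.
have h2 := ler_wpM2l (ltW c0) hv.
have h3 : sig * x / (mu * v) * (del * v) = 2 * (sig * x * del / (2 * mu)).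
  by field; rewrite !gt_eqF.
have h4 : 0 < sig * x * del / (2 * mu) by rewrite divr_gt0 ?mulr_gt0.
by clear -hw h1 h2 h3 h4; lra.
Qed.

(** A small defect forces density almost 2 on ]y', lam y']. If y < lam y', [window_bound] on ]y, lam
    y'] passes this on to ]y', y], and y - y' >= eta y' absorbs the error. Otherwise y exceeds lam
    y' by a factor of at most (1 + eta)^2, which is negligible against (lam - 1) y'. *)
Lemma chain_descent (lam eta tau B y y' : R) :
  1 < lam -> 0 < eta -> eta * lam <= (lam - 1) / 120 -> eta < 1 / 120 ->
  0 <= B -> 0 < tau -> window_bound tau B -> 0 < y' ->
  y' * (1 + eta) <= y -> y <= lam * (1 + eta) * (1 + eta) * y' ->
  (2 * (lam - 1) + tau * lam) * y' + B -
    (chebyshev (lam * y') - chebyshev y') <= eta / 30 * y' ->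
  19 / 10 * (y - y') <= chebyshev y - chebyshev y'.
Proof.
move=> lam1 eta0 etalam eta120 B0 tau0 HB y'0 y'y yy' dn.
have y0 : 0 <= y.
  by apply: le_trans y'y; rewrite ltW // mulr_gt0 // addr_gt0.
have [ly|ly] := leP (lam * y') y; last first.
  have := HB y (lam * y'); rewrite y0 (ltW ly) => /(_ isT) hb.
  have ey' : 0 < eta * y' by exact: mulr_gt0.
  by clear -dn hb y'y ey'; lra.
have h0 := le_chebyshev ly.
have h1 : 0 <= tau * lam * y' by rewrite !mulr_ge0 ?ltW //; lra.
have h2 : 0 <= (lam - 1) * y' by rewrite mulr_ge0 ?ltW ?subr_gt0.
have h3 : eta * lam * y' <= (lam - 1) / 120 * y' by rewrite ler_wpM2r // ltW.
have h4 : eta * lam * eta * y' <= (lam - 1) / 120 * y'.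
  rewrite ler_wpM2r ?(ltW y'0) //; apply: le_trans etalam.
  by rewrite -[leRHS]mulr1 ler_wpM2l // ?mulr_ge0 //; lra.
have h5 : eta * y' <= eta * lam * y'.
  by rewrite ler_wpM2r ?(ltW y'0) // -[leLHS]mulr1 ler_wpM2l // ltW.
by clear -h0 h1 h2 h3 h4 h5 dn yy' B0; lra.
Qed.

(** The next point is y' = x / n for some n of small defect. The factor 20 in Q keeps the window
    searched for n inside the block ]z, Q z] while y runs over ]x / (20 z), x / z]. *)
Lemma chain_step (lam eta tau B x z y mu Q del : R) :
  1 < lam -> 0 < eta -> eta * lam <= (lam - 1) / 120 -> eta < 1 / 120 ->
  0 <= B -> 0 < tau -> window_bound tau B -> 0 < x -> 1 <= z -> 0 < del ->
  mu = lam * (1 + eta) -> Q = mu * (1 + eta) * 20 ->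
  (forall v, z <= v -> del * v <= chebyshev (mu * v) - chebyshev v) ->
  let w n := mangoldt n * defect lam tau B x n in
  cumul w (Q * z) - cumul w z <= eta / 30 * x * del / (2 * mu) ->
  x / z / 20 < y <= x / z ->
  exists2 y', 0 < y' <= y / (1 + eta) &
    19 / 10 * (y - y') <= chebyshev y - chebyshev y'.
Proof.
move=> lam1 eta0 etalam eta120 B0 tau0 HB x0 z1 del0 muE QE hmu w light.
move=> /andP[yl yu].
have z0 : 0 < z by exact: lt_le_trans z1.
have e1 : 0 < 1 + eta by rewrite addr_gt0.
have mu1 : 1 < mu by rewrite muE; clear -lam1 eta0; nra.
have mu0 : 0 < mu by exact: lt_trans mu1.
have y0 : 0 < y by apply: lt_trans yl; rewrite !divr_gt0.
(* This v turns v < n <= mu v into y' (1 + eta) < y <= mu (1 + eta) y'. *)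
have [v vy] : exists v, v * y = (1 + eta) * x.
  by exists ((1 + eta) * x / y); rewrite divfK // gt_eqF.
have zyx : y * z <= x by rewrite -ler_pdivlMr.
have xzy : x <= y * 20 * z by rewrite -!ler_pdivrMr // ltW.
have zv : z <= v.
  by rewrite -(ler_pM2r y0) vy; clear -zyx x0 eta0; nra.
have v0 : 0 < v by exact: lt_le_trans zv.
have vQ : mu * v <= Q * z.
  rewrite -(ler_pM2r y0) -mulrA vy QE.
  have -> : mu * (1 + eta) * 20 * z * y = mu * ((1 + eta) * (y * 20 * z)).
    by ring.
  by rewrite ler_pM2l // ler_pM2l.
have dge n : (0 < n)%N -> 0 <= w n.
  by rewrite mulr_ge0 ?mangoldt_ge0 ?defect_ge0 // ltW.
have sig0 : 0 < eta / 30 by rewrite divr_gt0.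
have win : cumul w (mu * v) - cumul w v <= eta / 30 * x * del / (2 * mu).
  by apply: le_trans light; apply: lerB; exact: le_cumul.
have [n [nv nm dn]] := window_pick lam1 HB x0 sig0 mu1 v0 del0 (hmu v zv) win.
have n0 : 0 < n%:R :> R by exact: lt_trans nv.
have y'n : x / n%:R * n%:R = x by rewrite divfK // gt_eqF.
move: dn; rewrite /defect; move: (x / n%:R) y'n => y' y'n dn.
have y'0 : 0 < y' by rewrite -(pmulr_lgt0 _ n0) y'n.
have y'y : y' * (1 + eta) <= y.
  rewrite -(ler_pM2r n0) mulrAC y'n mulrC -vy mulrC ler_pM2l //; exact: ltW.
have yy' : y <= mu * (1 + eta) * y'.
  rewrite -(ler_pM2r n0) -[leRHS]mulrA y'n -mulrA -vy mulrA mulrC.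
  by rewrite ler_pM2r.
exists y'; first by rewrite y'0 ler_pdivlMr.
by apply: chain_descent dn; rewrite // -muE.
Qed.

Lemma positive_density_gt1 (lam0 : R) : 1 < lam0 -> positive_density lam0.
Proof.
move=> lam01; apply: contrapT => bad0.
(* (lam - 1) / lam increases with lam, so an eta fit for lam0 serves all larger lam. *)
have [eta [eta0 etalam0 eta120]] : exists eta, [/\ 0 < eta,
    forall lam, lam0 <= lam -> eta * lam <= (lam - 1) / 120 & eta < 1 / 120].
  exists ((lam0 - 1) / (120 * lam0)); split.
  - by rewrite divr_gt0 //; lra.
  - by move=> lam ?; rewrite mulrAC ler_pdivrMr; lra.
  - by rewrite ltr_pdivrMr; lra.
have [lam [lam0l bad [del del0 [y1 gmu]]]] :=
  maximal_not_positive_density lam01 eta0 bad0.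
have lam1 : 1 < lam by exact: lt_le_trans lam0l.
have etalam := etalam0 lam lam0l.
have [mu muE] : exists mu, mu = lam * (1 + eta) by eexists.
have mu1 : 1 < mu by rewrite muE; clear -lam1 eta0; nra.
rewrite -muE in gmu.
have [Q QE] : exists Q, Q = mu * (1 + eta) * 20 by eexists.
have Q1 : 1 < Q by rewrite QE; clear -mu1 eta0; nra.
have lQ : 0 < ln Q by rewrite ln_gt0.
have mu0 : 0 < mu by exact: lt_trans mu1.
(* Fitted so that the bound of [light_block] is the one [chain_step] requires. *)
have [theta th0 thE] : exists2 theta, 0 < theta &
    forall x, 4 * theta * ln Q * x = eta / 30 * x * del / (2 * mu).
  exists (eta / 30 * del / (8 * mu * ln Q)).
    by rewrite !divr_gt0 ?mulr_gt0.
  by move=> x; field; rewrite !gt_eqF.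
have [tau tau0 taut] : exists2 tau, 0 < tau & tau * lam < theta.
  have lam00 : 0 < lam by exact: lt_trans lam1.
  exists (theta / (2 * lam)); first by rewrite divr_gt0 ?mulr_gt0.
  have -> : theta / (2 * lam) * lam = theta / 2 by field; rewrite gt_eqF.
  by clear -th0; lra.
have [B B0 HB] := chebyshev_window_le tau0.
have [i0 hi0] : exists i0, y1 <= Q ^+ i0.
  have [|j] := @bernoulli_unbounded (Q - 1) y1; first by rewrite subr_gt0.
  by rewrite subrKC; exists j.
have [X hX] := light_block i0 Q1.
have [x hx [x1 small]] :=
  small_defect (Num.max X (3600 * 3600)) lam1 B0 tau0 bad taut.
move: hx; rewrite ge_max => /andP[xX x36].
have x1' : 1 < x by clear -x36; lra.
have x0 : 0 < x by exact: lt_trans x1'.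
set w := fun n => _ in small.
have w0 n : (0 < n)%N -> 0 <= w n.
  by rewrite mulr_ge0 ?mangoldt_ge0 ?defect_ge0 // ltW.
have xlx : x <= lam * x by rewrite -[leLHS]mul1r ler_wpM2r // ltW.
have [i [i0i Qi light]] := hX w x (lam * x) theta w0 th0 xX x1' xlx small.
have z1 : 1 <= Q ^+ i by rewrite exprn_ege1 // ltW.
have zy1 : y1 <= Q ^+ i.
  by apply: le_trans hi0 _; rewrite ler_weXn2l // ltW.
rewrite exprS thE in light Qi.
move: (Q ^+ i) z1 zy1 light Qi => z z1 zy1 light Qi.
have hmu v : z <= v -> del * v <= chebyshev (mu * v) - chebyshev v.
  by move=> zv; apply: gmu; exact: le_trans zv.
have step y := @chain_step lam eta tau B x z y mu Q del lam1 eta0 etalam eta120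
  B0 tau0 HB x0 z1 del0 muE QE hmu light.
have z0 : 0 < z by exact: lt_le_trans z1.
(* From z <= sqrt x and sqrt x >= 3600; it makes the error 8 sqrt (x / z) of Chebyshev's bound at
   most 8/60 of x / z. *)
have y0s : 3600 <= x / z.
  have sx : Num.sqrt x ^+ 2 = x by rewrite sqr_sqrtr // ltW.
  have sx36 : 3600 <= Num.sqrt x.
    have := sqrtr_ge0 x; clear -sx x36; move: (Num.sqrt x) sx => s sx s0.
    by rewrite leNgt; apply/negP => s36; nra.
  have : z <= Num.sqrt x.
    by apply: le_trans Qi; rewrite -[leLHS]mul1r ler_wpM2r // ltW.
  rewrite ler_pdivlMr //; clear -sx sx36 z0.
  by move: (Num.sqrt x) sx sx36 => s <-; nra.
move: (x / z) step y0s => y0; clear -eta0 => step y0s.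
have y00 : 0 < y0 by clear -y0s; lra.
(* Each step divides y by at least 1 + eta; the descent stops at y0 / 20, below which the block
   gives no control. *)
have chain j : exists2 y, 0 < y <= y0 &
    19 / 10 * (y0 - y) <= chebyshev y0 - chebyshev y /\
    (y <= y0 / 20 \/ y * (1 + eta) ^+ j <= y0).
  elim: j => [|j [y /andP[yp yu] [hy hj]]].
    exists y0; first by rewrite y00 lexx.
    by rewrite !subrr mulr0; split=> //; right; rewrite expr0 mulr1.
  have [ys|yb] := leP y (y0 / 20).
    by exists y; [rewrite yp yu|split=> //; left].
  have [|y' /andP[y'0 y'y] hy'] := step y; first by rewrite yb yu.
  move: y'y; rewrite ler_pdivlMr => [y'y|]; last by rewrite addr_gt0.
  have y'le : y' <= y by clear -y'y y'0 eta0; nra.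
  exists y'; first by rewrite y'0 (le_trans y'le).
  split; first by clear -hy hy'; lra.
  right; case: hj => [|hj]; first by rewrite leNgt yb.
  apply: le_trans hj; rewrite exprS mulrA ler_wpM2r // exprn_ge0 //.
  by rewrite addr_ge0 // ltW.
have [j hj] := @bernoulli_unbounded eta 20 eta0.
have [y /andP[yp _] [hy hs]] := chain j.
have ys : y <= y0 / 20.
  case: hs => // hs; rewrite ler_pdivlMr //; apply: le_trans hs.
  by rewrite ler_pM2l.
have := @chebyshev_le y0 (ltW y00); have := chebyshev_ge0 y.
have s60 : 60 <= Num.sqrt y0.
  have -> : 60 = Num.sqrt (60 ^+ 2) :> R by rewrite sqrtr_sqr ger0_norm.
  by rewrite ler_wsqrtr //; clear -y0s; lra.
have := sqr_sqrtr (ltW y00).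
move: (Num.sqrt y0) s60 => s s60 sE h1 h2.
(* The constants collide: the chain gives at least 19/10 times 19/20, or 1.805, and Chebyshev's
   bound at most 5/3 + 8/60 = 1.8. *)
have : 60 * s <= y0 by rewrite -sE expr2 ler_wpM2r //; clear -s60; lra.
by clear -hy ys h1 h2 y00; lra.
Qed.

End ErdosGapTheorem.

(** * Odd prime powers in short intervals *)

Section OddPrimePowers.
Set Implicit Arguments.
Unset Strict Implicit.
Variable R : realType.

(** The window ]n, (1 + e) n] has mass at least del n > 1 > ln 2. As e <= 1, it contains at most one
    power of 2, of weight ln 2, so an odd prime power must occur as well. *)
Lemma odd_prime_power_between (eps : R) : 0 < eps ->
  exists N, forall n, (N <= n)%N -> exists p k,
    [/\ prime p, odd p, (0 < k)%N, (n <= p ^ k)%N &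
        (p ^ k)%:R <= (1 + eps) * n%:R].
Proof.
move=> eps0; pose e := Num.min eps 1.
have e0 : 0 < e by rewrite lt_min eps0 ltr01.
have [e1 eeps] : e <= 1 /\ e <= eps by rewrite !ge_min !lexx orbT.
have [|del del0 [y0 hgood]] := @positive_density_gt1 R (1 + e); first lra.
exists (Num.truncn (Num.max y0 (1 / del))).+1 => n nN.
have : Num.max y0 (1 / del) < n%:R.
  by apply: lt_le_trans (truncnS_gt _) _; rewrite ler_nat.
rewrite gt_max ltr_pdivrMr // => /andP[y0n deln].
have n0 : 0 < n%:R :> R.
  by rewrite ltr0n; apply: leq_trans nN.
have n0' : (0 < n)%N by rewrite -(@ltr0n R).
have nen : n%:R <= (1 + e) * n%:R.
  by rewrite -[leLHS]mul1r ler_wpM2r //; lra.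
have := hgood _ (ltW y0n); rewrite cumulB // => hsum.
apply: contrapT => hn.
(* The largest power of 2 up to 2 n is the only one that can lie in ]n, 2 n]. *)
pose t := trunc_log 2 (2 * n).
suff : \sum_((Num.truncn (n%:R : R)).+1 <= m < (Num.truncn ((1 + e) * n%:R)).+1)
    mangoldt R m <= ln 2.
  by have := ln2_le R; lra.
apply: (@le_trans _ _ (\sum_((Num.truncn (n%:R : R)).+1 <=
    m < (Num.truncn ((1 + e) * n%:R)).+1 | m == (2 ^ t)%N) ln 2)); last first.
  by rewrite big_nat1_eq; case: ifP => // _; rewrite ln_ge0 // ler1n.
rewrite [leRHS]big_mkcond; apply: ler_sum_nat => m.
rewrite truncn_window //; last by rewrite mulr_ge0 //; lra.
rewrite ltr_nat => /andP[nm mn].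
have [->|/mangoldt_neq0[p [k [pp k0 mE]]]] := eqVneq (mangoldt R m) 0.
  by case: ifP => // _; rewrite ln_ge0 // ler1n.
have m2n : (m <= 2 * n)%N.
  rewrite -(@ler_nat R) natrM; apply: le_trans mn _.
  by rewrite ler_wpM2r //; lra.
have [podd|] := boolP (odd p).
  case: hn; exists p, k; split=> //; rewrite -mE; first exact: ltnW.
  by apply: le_trans mn _; rewrite ler_wpM2r //; lra.
move=> peven; have p2 : p = 2%N by case: (even_prime pp) peven => // ->.
have -> : (m == 2 ^ t)%N.
  have mE2 : m = (2 ^ k)%N by rewrite mE p2.
  rewrite {1}mE2 /t eqn_exp2l //; apply/eqP; apply/esym/trunc_log_eq => //.
  by rewrite expnS -mE2 m2n ltn_pmul2l.
by rewrite mE p2 mangoldt_pfactor.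
Qed.

End OddPrimePowers.

(** * Lower bound *)

Section BergeConfigurations.
Set Implicit Arguments.
Unset Strict Implicit.
Local Open Scope nat_scope.
Local Open Scope set_scope.
Implicit Type G : hypergraph3.

(** A Berge cycle inside G, given by its core vertices and edges instead of by a separate
    hypergraph. *)
Definition berge_config G l := exists (v : 'I_l -> G) (E : 'I_l -> {set G}),
  [/\ injective v, injective E, forall i, E i \in edges G &
      forall i, (v i \in E i) && (v (ordS i) \in E i)].

Lemma berge_config_contains G H l :
  berge_cycles l H -> contains G H -> berge_config G l.
Proof.
move=> [j [phi [injj sub injphi edg]]] [f injf fe].
exists (f \o j), (fun i => f @: phi i); split.
- exact: inj_comp.
- by move=> a b /(imset_inj injf)/injphi.
- by move=> i; apply: fe; apply/edg; exists i.
- move=> i; have h m : m \in [set i; ordS i] -> f (j m) \in f @: phi i.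
    by move=> mi; apply/imset_f/(fintype.subsetP (sub i))/imset_f.
  by rewrite !h // !inE eqxx ?orbT.
Qed.

Lemma berge_config_subgraph G l : berge_config G l ->
  exists2 H, berge_cycles l H & contains G H.
Proof.
move=> [v [E [injv injE EG vE]]].
have cH e : e \in [set E i | i : 'I_l] -> #|e| = 3.
  by move=> /imsetP[i _ ->]; exact: (@edges_card3 G).
exists (@Hypergraph3 G _ cH).
  exists v, E; split=> //.
    move=> i; apply/fintype.subsetP => u /imsetP[k]; have /andP[h1 h2] := vE i.
    by rewrite !inE => /orP[] /eqP -> ->.
  move=> e /=; split; first by move=> /imsetP[i _ ->]; exists i.
  by move=> [i <-]; exact: imset_f.
exists id; first by move=> ? ?.
by move=> e /imsetP[i _ ->]; rewrite imset_id.
Qed.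

Section SmallCycles.
Variable G : hypergraph3.
Hypothesis G5 : forall l, l \in [:: 2; 3; 4] -> ~ berge_config G l.

(** With cycles given as lists, the incidences of a concrete cycle are checked by computation. *)
Let no_cycle (x0 : G) (s : seq G) (t : seq {set G}) :
  size s \in [:: 2; 3; 4] -> size t = size s -> uniq s -> uniq t ->
  all (fun e => e \in edges G) t ->
  all (fun i => (nth x0 s i \in nth finset.set0 t i) &&
                (nth x0 s (i.+1 %% size s) \in nth finset.set0 t i))
      (iota 0 (size s)) ->
  False.
Proof.
move=> ls st us ut te inc; apply: (G5 ls).
exists (fun i => nth x0 s i), (fun i => nth finset.set0 t i); split.
- by move=> i j /eqP; rewrite nth_uniq // => /eqP/val_inj.
- by move=> i j /eqP; rewrite nth_uniq ?st // => /eqP/val_inj.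
- by move=> i; apply: (allP te); rewrite mem_nth ?st.
- by move=> i; apply: (allP inc); rewrite mem_iota /=.
Qed.

Lemma edge_linear e f x y : e \in edges G -> f \in edges G -> x != y ->
  x \in e -> y \in e -> x \in f -> y \in f -> e = f.
Proof.
move=> eG fG xy xe ye xf yf; apply/eqP/negPn/negP => ef.
apply: (@no_cycle x [:: x; y] [:: e; f]) => //=; rewrite ?inE ?xy ?ef //.
  by rewrite eG fG.
by rewrite xe ye xf yf.
Qed.

Lemma no_triangle e f g x y z : e \in edges G -> f \in edges G ->
  g \in edges G -> uniq [:: x; y; z] -> uniq [:: e; f; g] ->
  x \in e -> y \in e -> y \in f -> z \in f -> z \in g -> x \in g -> False.
Proof.
move=> eG fG gG u1 u2 h1 h2 h3 h4 h5 h6.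
apply: (@no_cycle x [:: x; y; z] [:: e; f; g]) => //=.
  by rewrite eG fG gG.
by rewrite h1 h2 h3 h4 h5 h6.
Qed.

Lemma no_quadrangle e f g h x y z t : e \in edges G -> f \in edges G ->
  g \in edges G -> h \in edges G -> uniq [:: x; y; z; t] ->
  uniq [:: e; f; g; h] -> x \in e -> y \in e -> y \in f -> z \in f ->
  z \in g -> t \in g -> t \in h -> x \in h -> False.
Proof.
move=> eG fG gG hG u1 u2 h1 h2 h3 h4 h5 h6 h7 h8.
apply: (@no_cycle x [:: x; y; z; t] [:: e; f; g; h]) => //=.
  by rewrite eG fG gG hG.
by rewrite h1 h2 h3 h4 h5 h6 h7 h8.
Qed.

Lemma edge_no4 e x y z t : e \in edges G -> uniq [:: x; y; z; t] ->
  x \in e -> y \in e -> z \in e -> t \in e -> False.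
Proof.
move=> /edges_card3 e3 u xe ye ze te.
have : size [:: x; y; z; t] <= #|e|.
  rewrite -(card_uniqP u); apply/subset_leq_card/fintype.subsetP => w.
  by rewrite !inE => /or4P[] /eqP ->.
by rewrite e3.
Qed.

(** Two paths with the same ends but different middle vertices close up to a Berge cycle of length
    4, or of length 3 or 2 if edges coincide, or else put four vertices on one edge. *)
Lemma two_path_inj e f e' f' v v' u w :
  [/\ e \in edges G, f \in edges G & e != f] ->
  [/\ e' \in edges G, f' \in edges G & e' != f'] ->
  [&& v \in e, v \in f, u \in e, u != v, w \in f & w != v] ->
  [&& v' \in e', v' \in f', u \in e', u != v', w \in f' & w != v'] ->
  [/\ v = v', e = e' & f = f'].
Proof.
move=> [eG fG ef] [eG' fG' ef'].
move=> /and5P[ve vf ue uv /andP[wf wv]] /and5P[ve' vf' ue' uv' /andP[wf' wv']].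
have uw : u != w.
  apply: contraNneq ef => uw; apply/eqP.
  by apply: (@edge_linear e f u v) => //; rewrite uw.
have [vv'|vv'] := eqVneq v v'.
  rewrite -vv' in ve' vf'; split=> //.
    by apply: (@edge_linear e e' u v).
  by apply: (@edge_linear f f' w v).
have [ee'|ee'] := eqVneq e e'.
  have [ff'|ff'] := eqVneq f f'.
    case/negP: ef; apply/eqP; apply: (@edge_linear e f v v') => //.
      by rewrite ee'.
    by rewrite ff'.
  case: (@no_triangle f f' e v w v') => //; rewrite ?ee' //=.
    by rewrite !inE negb_or vv' wv' eq_sym wv.
  rewrite !inE negb_or ff' (eq_sym f') ef' -ee' (eq_sym f) ef; done.
have [ff'|ff'] := eqVneq f f'.
  case: (@no_triangle e e' f v u v') => //; rewrite ?ff' //=.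
    by rewrite !inE negb_or vv' uv' eq_sym uv.
  by rewrite !inE negb_or ee' ef' -ff' ef.
have u4 : uniq [:: u; v; w; v'].
  by rewrite /= !inE !negb_or uv uw uv' (eq_sym v w) wv vv' wv'.
have [ef1|ef1] := eqVneq e f'.
  by case: (@edge_no4 e u v w v'); rewrite // ef1.
have [fe1|fe1] := eqVneq f e'.
  by case: (@edge_no4 f u v w v'); rewrite // fe1.
case: (@no_quadrangle e f f' e' u v w v') => //.
by rewrite /= !inE !negb_or ef ef1 ee' ff' fe1 (eq_sym f') ef'.
Qed.

(** * Counting paths of two edges *)

Definition edges_at (v : G) := [set e in edges G | v \in e].

Definition two_path (x : (G * ({set G} * {set G})) * (G * G)) : bool :=
  let: ((v, (e, f)), (u, w)) := x in
  [&& e \in edges_at v, f \in edges_at v & e != f] &&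
  [&& u \in e :\ v & w \in f :\ v].

(** The 4 is two choices of an end on each of the two edges at v. *)
Lemma card_two_path :
  #|[set x | two_path x]| = \sum_(v : G) 4 * (#|edges_at v| * #|edges_at v|.-1).
Proof.
pose P (p : G * ({set G} * {set G})) :=
  [&& p.2.1 \in edges_at p.1, p.2.2 \in edges_at p.1 & p.2.1 != p.2.2].
pose Q (p : G * ({set G} * {set G})) (q : G * G) :=
  (q.1 \in p.2.1 :\ p.1) && (q.2 \in p.2.2 :\ p.1).
transitivity (\sum_(p | P p) \sum_(q | Q p q) 1).
  rewrite pair_big_dep sum1_card /=; apply: eq_card => -[[v [e f]] [u w]].
  by rewrite !inE.
transitivity (\sum_(p | P p) 4).
  apply: eq_bigr => -[v [e f]] /=; rewrite /P /= !inE.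
  move=> /and3P[/andP[eG ve] /andP[fG vf] _].
  have c2 g : g \in edges G -> v \in g -> #|g :\ v| = 2.
    by move=> /edges_card3 g3 vg; have := cardsD1 v g; rewrite vg g3 => -[].
  rewrite sum1_card -[4]/(2 * 2) -{1}(c2 _ eG ve) -(c2 _ fG vf) -cardsX.
  by apply: eq_card => -[u w]; rewrite unfold_in /= !inE.
rewrite -(pair_big_dep xpredT (fun v (q : {set G} * {set G}) =>
   [&& q.1 \in edges_at v, q.2 \in edges_at v & q.1 != q.2]) (fun _ _ => 4)) /=.
apply: eq_bigr => v _; rewrite sum_nat_const mulnC; congr (_ * _).
set A := edges_at v.
transitivity (\sum_(e in A) #|A :\ e|).
  transitivity (\sum_(e in A) \sum_(f in A :\ e) 1); last first.
    by apply: eq_bigr => e _; rewrite sum1_card.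
  rewrite pair_big_dep sum1_card /=; apply: eq_card => -[e f].
  rewrite unfold_in /= [RHS]unfold_in /= in_setD1 (eq_sym f).
  by rewrite [(e != f) && _]andbC.
rewrite (eq_bigr (fun=> #|A|.-1)) ?sum_nat_const // => e eA.
by have := cardsD1 e A; rewrite eA => ->.
Qed.

(** By [two_path_inj] a path is determined by its ordered pair of ends. *)
Lemma sum_two_path_le :
  \sum_(v : G) 4 * (#|edges_at v| * #|edges_at v|.-1) <= #|G| ^ 2.
Proof.
rewrite -card_two_path -(@card_in_imset _ _ (fun x => x.2)).
  by rewrite -mulnn -card_prod max_card.
move=> [[v [e f]] [u w]] [[v' [e' f']] [u' w']] /=; rewrite !inE /= !inE.
move=> h1 h2 [uu ww]; rewrite -uu -ww in h2 *.
move: h1 h2 => /andP[/and3P[/andP[eG ve] /andP[fG vf] ef]] /andP[uv wv].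
move=> /andP[/and3P[/andP[eG' ve'] /andP[fG' vf'] ef']] /andP[uv' wv'].
move: uv wv uv' wv' => /andP[uv ue] /andP[wv wf] /andP[uv' ue'] /andP[wv' wf'].
have [||||-> -> ->] // := @two_path_inj e f e' f' v v' u w.
  by rewrite ve vf ue uv wf wv.
by rewrite ve' vf' ue' uv' wf' wv'.
Qed.

Lemma sum_edges_at : \sum_(v : G) #|edges_at v| = 3 * #|edges G|.
Proof.
transitivity (\sum_(v : G) \sum_(e in edges G | v \in e) 1).
  apply: eq_bigr => v _; rewrite sum1_card.
  by apply: eq_card => e; rewrite !inE.
rewrite (exchange_big_dep (mem (edges G))) /=; last by move=> v e _ /andP[].
rewrite mulnC -sum_nat_const; apply: eq_bigr => e eG.
rewrite -(edges_card3 eG) -sum1_card.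
by apply: eq_bigl => v; rewrite eG.
Qed.

End SmallCycles.

(** Send an edge to the set of parts it meets. An edge has three vertices and the parts are
    disjoint, so the edge provided for I meets exactly the parts in I; every I is attained. *)
Lemma card_edges_rk r k G : is_rk_hypergraph r k G -> 'C(r, 3) <= #|edges G|.
Proof.
move=> [V [cov disj _ cross]].
rewrite -[r in 'C(r, _)]card_ord -card_draws.
pose tr (e : {set G}) := [set i | e :&: V i != finset.set0].
apply: leq_trans (leq_imset_card tr (edges G)).
apply/subset_leq_card/fintype.subsetP => I; rewrite inE => /eqP I3.
have [e eG eI] := cross I I3; apply/imsetP; exists e => //.
have IT : I \subset tr e.
  by apply/fintype.subsetP => i iI; rewrite inE -card_gt0 eI.
apply/eqP; rewrite eqEcard IT I3 -(edges_card3 eG).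
rewrite -[leqLHS]sum1_card.
apply: (@leq_trans (\sum_i #|e :&: V i|)).
  rewrite big_mkcond; apply: leq_sum => i _.
  by case: ifP => //; rewrite inE card_gt0.
under eq_bigr do rewrite -sum1_card.
rewrite (exchange_big_dep (mem e)) /=; last first.
  by move=> i v _; rewrite inE => /andP[].
rewrite -[leqRHS]sum1_card; apply: leq_sum => v ve; rewrite sum1_card.
have memE i : pred_of_set (e :&: V i) v = (v \in V i).
  by rewrite -[LHS]/(v \in e :&: V i) inE ve.
apply/card_le1P => i; rewrite unfold_in memE => vi j.
rewrite unfold_in memE inE.
apply/idP/eqP => [vj|->//]; apply/eqP/negPn/negP => /disj.
by move=> /pred0P/(_ v) /=; rewrite vj vi.
Qed.

(** Sums (2 d - r)^2 >= 0 over the vertices; r / 2 is about the average degree in the extremal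
    case. *)
Lemma sum_sqr_ge (T : finType) (d : T -> nat) r :
  4 * r * (\sum_v d v) <= 4 * \sum_v (d v * (d v).-1) + 4 * (\sum_v d v)
                          + r ^ 2 * #|T|.
Proof.
rewrite -[#|T|]sum1_card !big_distrr -!big_split /=; apply: leq_sum => v _.
rewrite muln1; case: (d v) => [|n] /=; first by rewrite !muln0.
by have [h _] := nat_Cauchy (2 * n.+1) r; rewrite -!mulnn in h *; nia.
Qed.

(** Here n, m and s stand for the number of vertices, the number of edges and the sum of d (d - 1).
    The hypotheses combine to 2 (r - 1)^2 (r - 2) <= r k (k + r), which fails for k <= r - 5. *)
Lemma counting_contradiction r k n m s : 3 <= r -> n <= r * k ->
  4 * r * (3 * m) <= 4 * s + 4 * (3 * m) + r ^ 2 * n -> 4 * s <= n ^ 2 ->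
  r * r.-1 * r.-2 <= 6 * m -> r <= k + 4.
Proof.
case: r => [//|[//|[//|q]]] _ nrk h1 h2 h3; rewrite leqNgt; apply/negP => kr.
have [j qE] : exists j, q = k + 2 + j by exists (q - (k + 2)); lia.
rewrite /= -!mulnn in h1 h2 h3.
have a1 : n * n <= (q.+3 * k) * (q.+3 * k) by exact: leq_mul.
have a2 : q.+3 * q.+3 * n <= q.+3 * q.+3 * (q.+3 * k).
  by rewrite leq_mul2l nrk orbT.
have a3 := leq_mul (leqnn (2 * q.+2)) h3.
have : q.+3 * (2 * (q.+2 * q.+2 * q.+1)) <= q.+3 * (q.+3 * k * (k + q.+3)).
  by clear -h1 h2 a1 a2 a3; nia.
by rewrite leq_pmul2l // qE; clear; nia.
Qed.

Lemma leq_admissible r k : 3 <= r -> admissible r berge_cycles_234 k ->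
  r <= k + 4.
Proof.
move=> r3 [_ [G rkG free]].
have G5 l : l \in [:: 2; 3; 4] -> ~ berge_config G l.
  move=> l234 /berge_config_subgraph[H Hl]; apply: free.
  by move: l234 Hl; rewrite !inE => /or3P[] /eqP -> Hl;
    [apply: Or31|apply: Or32|apply: Or33].
have nG : #|G| <= r * k.
  case: rkG => V [cov _ Vk _]; rewrite -cardsT -cov.
  apply: (@leq_trans (\sum_(i < r) #|V i|)).
    apply: (big_rec2 (fun (A : {set G}) (n : nat) => #|A| <= n)).
      by rewrite cards0.
    move=> i A n _ An.
    by apply: leq_trans (leq_card_setU _ _) _; rewrite leq_add2l.
  by rewrite -[r in r * k]card_ord -sum_nat_const leq_sum.
have := card_edges_rk rkG; have := sum_two_path_le G5.
have := sum_sqr_ge (fun v : G => #|edges_at v|) r; rewrite sum_edges_at //.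
rewrite -big_distrr /=; move: (\sum_(v : G) _) => s h1 h2 h3.
have h4 : r * r.-1 * r.-2 <= 6 * #|edges G|.
  have -> : r * r.-1 * r.-2 = 6 * 'C(r, 3).
    by have := bin_ffact r 3; rewrite !ffactnS ffactn0 muln1 mulnC => ->;
      rewrite mulnA.
  by rewrite leq_mul2l h3.
by apply: counting_contradiction h1 h2 h4.
Qed.

End BergeConfigurations.

(** * Upper bound *)

Section PolarityHypergraph.
Set Implicit Arguments.
Unset Strict Implicit.
Local Open Scope nat_scope.
Local Open Scope set_scope.
Variables (F : finFieldType) (r : nat) (a : 'I_r -> F).
Hypothesis inja : injective a.
Hypothesis two_neq0 : (2 != 0 :> F)%R.

(** The vertex (i, y) stands for the point (a i, y) of the affine plane. *)
Definition polar (u v : 'I_r * F) :=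
  (u.1 != v.1) && (u.2 + v.2 == a u.1 * a v.1)%R.

Lemma polar_sym u v : polar u v = polar v u.
Proof. by rewrite /polar eq_sym addrC mulrC. Qed.

Lemma polar_neq u v : polar u v -> u != v.
Proof. by move=> /andP[uv _]; apply: contraNneq uv => ->. Qed.

(** The four equations combine to (a u.1 - a w.1) (a b.1 - a c.1) = 0; equal first coordinates then
    force equal second ones. *)
Lemma polar_C4_free u w b c : u != w -> b != c ->
  polar u b -> polar w b -> polar u c -> polar w c -> False.
Proof.
move=> uw bc /andP[_ /eqP ub] /andP[_ /eqP wb].
move=> /andP[_ /eqP uc] /andP[_ /eqP wc].
have : ((a u.1 - a w.1) * (a b.1 - a c.1) == 0)%R.
  apply/eqP; rewrite mulrBl !mulrBr -ub -uc -wb -wc; ring.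
rewrite mulf_eq0 !subr_eq0 => /orP[] /eqP/inja e1.
  case/negP: uw; apply/eqP; apply: injective_projections => //.
  by apply: (addIr b.2); rewrite ub wb e1.
case/negP: bc; apply/eqP; apply: injective_projections => //.
by apply: (addrI u.2); rewrite ub uc e1.
Qed.

Definition polar_triangles : {set {set 'I_r * F}} :=
  [set e : {set 'I_r * F} | (#|e| == 3) &&
    [forall u in e, forall v in e, (u != v) ==> polar u v]].

Lemma polar_triangles_card3 e : e \in polar_triangles -> #|e| = 3.
Proof. by rewrite inE => /andP[/eqP]. Qed.

Definition polar_hypergraph := Hypergraph3 polar_triangles_card3.

Lemma polar_trianglesP e u v : e \in polar_triangles ->
  u \in e -> v \in e -> u != v -> polar u v.
Proof.
rewrite inE => /andP[_ /forall_inP h] ue ve uv.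
by have /forall_inP/(_ v ve)/implyP := h u ue; exact.
Qed.

Lemma polar_triangle_mem u v w : polar u v -> polar v w -> polar u w ->
  [set u; v; w] \in polar_triangles.
Proof.
move=> uv vw uw; rewrite inE; apply/andP; split.
  by rewrite -finset.setUA !cardsU1 cards1 !inE negb_or !polar_neq.
apply/forall_inP => x; rewrite !inE => hx.
apply/forall_inP => y; rewrite !inE => hy; apply/implyP; move: hx hy.
by do 2![move=> /orP[/orP[]|] /eqP ->]; rewrite ?eqxx // 1?polar_sym.
Qed.

(* The third vertices of two triangles on u v would close a C4. *)
Lemma polar_triangle_uniq e f u v : e \in polar_triangles ->
  f \in polar_triangles -> u != v -> u \in e -> v \in e -> u \in f -> v \in f ->
  e = f.
Proof.
move=> eT fT uv ue ve uf vf; apply/eqP; rewrite eqEcard.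
rewrite !polar_triangles_card3 // andbT; apply/fintype.subsetP => w we.
have [->//|wu] := eqVneq w u; have [->//|wv] := eqVneq w v.
have : 0 < #|f :\: [set u; v]|.
  rewrite cardsD polar_triangles_card3 // subn_gt0 ltnS.
  apply: leq_trans (subset_leq_card (finset.subsetIr _ _)) _.
  by rewrite cards2 uv.
move=> /card_gt0P[w']; rewrite !inE negb_or => /andP[/andP[w'u w'v] w'f].
have [<-//|ww'] := eqVneq w' w.
case: (@polar_C4_free u v w w') => //; first by rewrite eq_sym.
- by apply: (polar_trianglesP eT); rewrite // eq_sym.
- by apply: (polar_trianglesP eT); rewrite // eq_sym.
- by apply: (polar_trianglesP fT); rewrite // eq_sym.
- by apply: (polar_trianglesP fT); rewrite // eq_sym.
Qed.

(** Consecutive core vertices are adjacent. For l = 2 two triangles share two vertices; for l = 3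
    the core is itself a triangle, sharing two vertices with each of two edges, which must then
    coincide; for l = 4 the core is a C4. *)
Lemma polar_no_config l : l \in [:: 2; 3; 4] ->
  ~ berge_config polar_hypergraph l.
Proof.
move=> l234 [v [E [injv injE ET vE]]].
have adj i : ordS i != i -> polar (v i) (v (ordS i)).
  move=> Si; have /andP[h1 h2] := vE i; apply: (polar_trianglesP (ET i)) => //.
  by rewrite (inj_eq injv) eq_sym.
move: l234 v E injv injE ET vE adj; rewrite !inE.
move=> /or3P[] /eqP -> v E injv injE ET vE adj.
- have /andP[a0 a1] := vE ord0; have /andP[b0 b1] := vE ord_max.
  have S0 : ordS ord0 = ord_max :> 'I_2 by exact: val_inj.
  have S1 : ordS ord_max = ord0 :> 'I_2 by exact: val_inj.
  rewrite S0 S1 in a1 b1.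
  have : E ord0 = E ord_max.
    apply: (@polar_triangle_uniq _ _ (v ord0) (v ord_max)) => //.
    by rewrite (inj_eq injv).
  by move/injE.
- pose i0 : 'I_3 := ord0; pose i1 : 'I_3 := inord 1; pose i2 : 'I_3 := inord 2.
  have S0 : ordS i0 = i1 by apply: val_inj; rewrite /= inordK.
  have S1 : ordS i1 = i2 by apply: val_inj; rewrite /= !inordK.
  have S2 : ordS i2 = i0 by apply: val_inj; rewrite /= !inordK.
  have [n01 n12 n02] : [/\ i0 != i1, i1 != i2 & i0 != i2].
    by rewrite -!val_eqE /= !inordK.
  have := adj i0; have := adj i1; have := adj i2; rewrite S0 S1 S2.
  rewrite n02 (eq_sym i2) n12 (eq_sym i1) n01.
  move=> /(_ isT) h20 /(_ isT) h12 /(_ isT) h01.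
  have tT := polar_triangle_mem h01 h12 (etrans (polar_sym _ _) h20).
  have := vE i0; have := vE i1; rewrite S0 S1 => /andP[b1 b2] /andP[a0 a1].
  apply: (negP n01); apply/eqP/injE.
  transitivity [set v i0; v i1; v i2].
    apply: (polar_triangle_uniq (ET i0) tT _ a0 a1); rewrite ?(inj_eq injv) //.
      by rewrite !inE eqxx.
    by rewrite !inE eqxx orbT.
  apply/esym/(polar_triangle_uniq (ET i1) tT _ b1 b2).
      by rewrite (inj_eq injv).
    by rewrite !inE eqxx orbT.
  by rewrite !inE eqxx orbT.
- pose i0 : 'I_4 := ord0; pose i1 : 'I_4 := inord 1; pose i2 : 'I_4 := inord 2.
  pose i3 : 'I_4 := inord 3.
  have S0 : ordS i0 = i1 by apply: val_inj; rewrite /= inordK.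
  have S1 : ordS i1 = i2 by apply: val_inj; rewrite /= !inordK.
  have S2 : ordS i2 = i3 by apply: val_inj; rewrite /= !inordK.
  have S3 : ordS i3 = i0 by apply: val_inj; rewrite /= !inordK.
  have adj' i : polar (v i) (v (ordS i)).
    apply: adj; rewrite -val_eqE /=; case: i => [[|[|[|[|]]]]] //.
  have := adj' i0; have := adj' i1; have := adj' i2; have := adj' i3.
  rewrite S0 S1 S2 S3 => h30 h23 h12 h01.
  case: (@polar_C4_free (v i0) (v i2) (v i1) (v i3)) => //.
  + by rewrite (inj_eq injv) -val_eqE /= !inordK.
  + by rewrite (inj_eq injv) -val_eqE /= !inordK.
  + by rewrite polar_sym.
  + by rewrite polar_sym.
Qed.

Lemma polar_rk : is_rk_hypergraph r #|F| polar_hypergraph.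
Proof.
exists (fun i => [set u : 'I_r * F | u.1 == i]); split.
- apply/setP => u; rewrite inE; apply/bigcupP; exists u.1 => //.
  by rewrite inE.
- move=> i j ij; apply/pred0P => u /=; rewrite !inE.
  by case: eqP => [->|//]; rewrite (negbTE ij).
- move=> i; apply: leq_trans (leq_imset_card (pair i) (mem F)).
  apply/subset_leq_card/fintype.subsetP => -[j y]; rewrite inE /= => /eqP ->.
  exact: imset_f.
move=> I I3.
have [i [j [l [ij il jl ->]]]] : exists i j l,
    [/\ i != j, i != l, j != l & I = [set i; j; l]].
  have /card_gt0P[i iI] : 0 < #|I| by rewrite I3.
  have := cardsD1 i I; rewrite iI I3 add1n => -[] I2.
  have /card_gt0P[j jI] : 0 < #|I :\ i| by rewrite -I2.
  have := cardsD1 j (I :\ i); rewrite jI -I2 add1n => -[] I1.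
  have /cards1P[l lE] : #|I :\ i :\ j| == 1 by rewrite -I1.
  have : l \in I :\ i :\ j by rewrite lE inE.
  move: jI; rewrite !inE => /andP[ji jI] /and3P[lj li lI].
  exists i, j, l; split; rewrite 1?eq_sym //.
  have jIi : j \in I :\ i by rewrite !inE ji.
  by rewrite -(finset.setD1K iI) -(finset.setD1K jIi) lE finset.setUA.
(* The solution of the three equations y_i + y_j = a_i a_j; this is where 2 must be invertible. *)
pose y (s t p : 'I_r) : F := ((a s * a t + a s * a p - a t * a p) / 2)%R.
have yE s t p : (y s t p + y t s p)%R = (a s * a t)%R.
  by rewrite /y; field.
have yC s t p : y s t p = y s p t by rewrite /y; congr (_ / _)%R; ring.
pose e : {set 'I_r * F} := [set (i, y i j l); (j, y j i l); (l, y l i j)].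
have eT : e \in polar_triangles.
  apply: polar_triangle_mem; rewrite /polar /= ?ij ?jl ?il /=; apply/eqP.
  - by rewrite yE.
  - by rewrite (yC j) (yC l) yE.
  - by rewrite (yC i) yE.
exists e => // s sI.
have [u ue us] : exists2 u, u \in e & u.1 = s.
  move: sI; rewrite !inE => /orP[/orP[]|] /eqP ->.
  - by exists (i, y i j l); rewrite // !inE eqxx.
  - by exists (j, y j i l); rewrite // !inE eqxx ?orbT.
  - by exists (l, y l i j); rewrite // !inE eqxx ?orbT.
apply/eqP/cards1P; exists u; apply/setP => v.
rewrite finset.in_setI [in X in _ && X]inE [RHS]inE.
apply/andP/eqP => [[ve /eqP vs]|->]; last by rewrite us.
(* Another vertex of the triangle in the same part would be adjacent to u, but adjacency requires
   distinct parts. *)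
apply/eqP/negPn/negP => /(polar_trianglesP eT ve ue)/andP[].
by rewrite vs us eqxx.
Qed.

Lemma admissible_polar : 0 < r -> admissible r berge_cycles_234 #|F|.
Proof.
move=> r0; split; first by apply/card_gt0P; exists 0%R.
exists polar_hypergraph; first exact: polar_rk.
move=> H HF cH.
have [l l234 Hl] : exists2 l, l \in [:: 2; 3; 4] & berge_cycles l H.
  by case: HF; [exists 2|exists 3|exists 4].
exact: (polar_no_config l234 (berge_config_contains Hl cH)).
Qed.

End PolarityHypergraph.

Section FiniteFields.
Set Implicit Arguments.
Unset Strict Implicit.
Local Open Scope nat_scope.

Lemma admissible_odd_prime_power r p k : prime p -> odd p -> 0 < k ->
  0 < r <= p ^ k -> admissible r berge_cycles_234 (p ^ k).
Proof.
move=> pp podd k0 /andP[r0 rq].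
have [F chF FE] := pPrimePowerField pp k0; rewrite -FE.
have rF : r <= #|F| by rewrite FE.
pose a (i : 'I_r) : F := enum_val (widen_ord rF i).
apply: (@admissible_polar F r a) => //.
  by move=> i j /enum_val_inj[]/val_inj.
rewrite -(dvdn_pcharf chF) dvdn_prime2 //.
by apply: contraL podd => /eqP ->.
Qed.

End FiniteFields.

Theorem theorem1p10 (R : realType) :
  exists h : nat -> R,
    (h r / r%:R @[r --> \oo] --> (0 : R)) /\
    forall r : nat, (3 <= r)%N ->
      (f3 r berge_cycles_234)%:R = r%:R + h r.
Proof.
exists (fun r => (f3 r berge_cycles_234)%:R - r%:R); split; last first.
  by move=> r _; rewrite subrKC.
(* A prime above r >= 3 is odd; it shows that [f3] is a genuine minimum. *)
have adm r : (3 <= r)%N -> exists k, admissible r berge_cycles_234 k.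
  move=> r3; have [p rp pp] := prime_above r; exists (p ^ 1)%N.
  apply: admissible_odd_prime_power => //.
    by case: (even_prime pp) => // p2; move: rp; rewrite p2; lia.
  by rewrite expn1 (ltnW rp) andbT (leq_trans _ r3).
apply/cvgrPdist_lt => eps eps0.
have e20 : 0 < eps / 2 by rewrite divr_gt0.
have [N hN] := odd_prime_power_between e20.
near=> r.
have r3 : (3 <= r)%N by near: r; exact: nbhs_infty_ge.
have rN : (N <= r)%N by near: r; exact: nbhs_infty_ge.
have r0 : 0 < r%:R :> R by rewrite ltr0n (leq_trans _ r3).
(* Absorbs the loss of 4 in the lower bound. *)
have er : 4 < eps * r%:R.
  rewrite -ltr_pdivrMl //; near: r; exact: nbhs_infty_gtr.
have [p [k [pp podd k0 rq qr]]] := hN r rN.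
have [admf minf] := f3P (adm r r3).
have := leq_admissible r3 admf; rewrite -(@ler_nat R) natrD => hlo.
have : (f3 r berge_cycles_234 <= p ^ k)%N.
  by apply/minf/admissible_odd_prime_power => //; rewrite rq (leq_trans _ r3).
rewrite -(@ler_nat R) => hup.
rewrite sub0r normrN normrM normfV (gtr0_norm r0) ltr_pdivrMr //.
rewrite ltr_norml; apply/andP; split; lra.
Unshelve. all: by end_near.
Qed.
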